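(* In the case of constant pressure $P=P_0$ and constant velocity $\boldsymbol{v}=\boldsymbol{v}_0$, the corrected pressure-based DG scheme with the modified correction term $\boldsymbol{r}_k=\alpha(\widehat{\boldsymbol{z}}_k-\overline{\boldsymbol{z}})$ (together with the face-based correction of the numerical flux for elementwise-constant solutions, as specified in the context) preserves velocity and pressure equilibria, i.e. $\partial_t\boldsymbol{v}=0$ and $\partial_tP=0$, and, assuming continuity in time (so that $\boldsymbol{w}\cdot\partial_t\boldsymbol{y}=\partial_t(\rho e_t)$ by the chain rule), conserves total energy in the semi-discrete sense: on each element $\kappa$, $$\sum_{i=1}^{n_q}\omega_{q,i}\,\partial_t(\rho e_t)(\boldsymbol{x}_{q,i})=\sum_{k,j=1}^{n_b}\widehat{\boldsymbol{w}}_k^T\mathcal{M}_{kj}\frac{d\widehat{\boldsymbol{y}}_j}{dt}=-\oint_{\partial\kappa}\mathcal{F}^\dagger_{\rho e_t}(\boldsymbol{y}^+,\boldsymbol{y}^-,\boldsymbol{n})\,ds.$$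
   Context: State: $\boldsymbol{y}=(\rho v_1,\dots,\rho v_d,P,C_1,\dots,C_{n_s})^T\in\mathbb{R}^m$, with $\boldsymbol{v}$ velocity, $P$ pressure, $C_i$ molar concentrations, $W_i$ molar masses, $\rho=\sum_iW_iC_i>0$. Mixture of thermally perfect gases: $P=R^0T\sum_iC_i$, with $R^0$ the universal gas constant, $\rho u=\sum_iW_iC_iu_i(T)$, $u_i(T)=h_{\mathrm{ref},i}+\int_{T_{\mathrm{ref}}}^Tc_{p,i}(\tau)d\tau-(R^0/W_i)T$ with $c_{p,i}$ polynomial in temperature, $\rho e_t=\rho u+\frac12\rho\,\boldsymbol{v}\cdot\boldsymbol{v}$; $\rho c_v=\sum_iW_iC_i(c_{p,i}-R^0/W_i)$; $c^2=\gamma P/\rho$ with $\gamma$ the mixture specific heat ratio. Velocity evolution: $\partial_t\boldsymbol{v}=\frac1\rho\partial_t(\rho\boldsymbol{v})-\frac{\boldsymbol{v}}\rho\partial_t\rho$. ''Constant pressure and velocity'' means $P\equiv P_0$, $\boldsymbol{v}\equiv\boldsymbol{v}_0$ at the given time. Notation: on an element $\kappa$ (all faces interior), $\boldsymbol{y}=\sum_{j=1}^{n_b}\widehat{\boldsymbol{y}}_j\phi_j$ with $\{\phi_j\}$ a (nodal) basis of $\mathcal{P}_p(\kappa)$, the polynomials of degree at most $p$; $\mathcal{M}_{ij}=\int_\kappa\phi_i\phi_jdx$; $\boldsymbol{n}$ is the outward normal; superscripts $+$, $-$ denote interior and neighbor traces; $[\![a]\!]=a^+-a^-$; $\{\!\{a\}\!\}=\frac12(a^++a^-)$.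 Integrals in the residual and over faces are evaluated exactly. Fluxes: $\boldsymbol{\mathcal{F}}_k(\boldsymbol{y})=(\rho v_kv_1+P\delta_{k1},\dots,\rho v_kv_d+P\delta_{kd},Pv_k,v_kC_1,\dots,v_kC_{n_s})^T$; $\boldsymbol{\mathcal{F}}_{\rho e_t}(\boldsymbol{y})=\boldsymbol{v}(\rho e_t+P)$; Lax–Friedrichs flux $\widetilde{\boldsymbol{\mathcal{F}}}^\dagger=\{\!\{\boldsymbol{\mathcal{F}}(\boldsymbol{y})\}\!\}\cdot\boldsymbol{n}+\frac12\lambda[\![\boldsymbol{y}]\!]$ ($\lambda$ a wave speed estimate). $\boldsymbol{\mathcal{B}}(\boldsymbol{y}):\nabla\boldsymbol{y}$ has only a nonzero pressure component $(\rho c^2-P)\nabla\cdot\boldsymbol{v}$, with $\boldsymbol{\mathcal{B}}_{P,k}=\frac{\rho c^2-P}{\rho}(\delta_{k1},\dots,\delta_{kd},0,-W_1v_k,\dots,-W_{n_s}v_k)^T$; $\boldsymbol{\mathcal{D}}$ has only a nonzero pressure component $\mathcal{D}_P=\frac12(\boldsymbol{\mathcal{B}}_P\cdot\boldsymbol{n})|_{\{\!\{\boldsymbol{y}\}\!\}}\cdot(\boldsymbol{y}^--\boldsymbol{y}^+)$. Auxiliary variables: $$\boldsymbol{w}=\frac{\partial(\rho e_t)}{\partial\boldsymbol{y}}=\Big(v_1,\dots,v_d,\ \tfrac{\rho c_v}{R^0\sum_jC_j},\ \tfrac{\partial(\rho e_t)}{\partial C_1},\dots,\tfrac{\partial(\rho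 e_t)}{\partial C_{n_s}}\Big)^T,\quad \tfrac{\partial(\rho e_t)}{\partial C_i}=W_iu_i-\tfrac{\rho c_vP}{R^0(\sum_jC_j)^2}-\tfrac{W_i}2\boldsymbol{v}\cdot\boldsymbol{v},$$ $$\boldsymbol{z}=\Big(v_1\sum_iW_i\tfrac{\partial(\rho e_t)}{\partial C_i},\dots,v_d\sum_iW_i\tfrac{\partial(\rho e_t)}{\partial C_i},\ P,\ \tfrac{\partial(\rho e_t)}{\partial C_1},\dots,\tfrac{\partial(\rho e_t)}{\partial C_{n_s}}\Big)^T.$$ For $\boldsymbol{a}\in\{\boldsymbol{w},\boldsymbol{z}\}$, $\widehat{\boldsymbol{a}}_k\in\mathbb{R}^m$ ($k=1,\dots,n_b$) are the coefficients of its quadrature-based $L^2$ projection onto $[\mathcal{P}_p(\kappa)]^m$: $\widehat{\boldsymbol{a}}=\mathcal{M}^{-1}\boldsymbol{V}_q^T\boldsymbol{W}\boldsymbol{a}(\boldsymbol{y}_q)$, where $\boldsymbol{x}_{q,i},\omega_{q,i}$ ($i=1,\dots,n_q$) are quadrature points and weights on $\kappa$, $\boldsymbol{W}=\mathrm{diag}(\omega_{q,i})$, $(V_q)_{ij}=\phi_j(\boldsymbol{x}_{q,i})$, $\boldsymbol{y}_q=\boldsymbol{V}_q\widehat{\boldsymbol{y}}$ (the rule being accurate enough that this projection reproduces constants); $\overline{\boldsymbol{a}}=\frac1{n_b}\sum_k\widehat{\boldsymbol{a}}_k$. In face terms, $\widehat{\boldsymbol{w}}$, $\boldsymbol{w}$,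 $\widehat{\boldsymbol{z}}$ denote traces of the projected polynomials $\sum_k\widehat{\boldsymbol{w}}_k\phi_k$, $\sum_k\widehat{\boldsymbol{z}}_k\phi_k$. Scheme. (i) Numerical flux: $\boldsymbol{\mathcal{F}}^\dagger=\widetilde{\boldsymbol{\mathcal{F}}}^\dagger+\beta[\![\widehat{\boldsymbol{z}}]\!]$ with $$\beta=\frac{-[\![\boldsymbol{\mathcal{F}}_{\rho e_t}(\boldsymbol{y})]\!]\cdot\boldsymbol{n}-[\![\widehat{\boldsymbol{w}}]\!]^T\widetilde{\boldsymbol{\mathcal{F}}}^\dagger+[\![\widehat{\boldsymbol{w}}^T\boldsymbol{\mathcal{F}}(\boldsymbol{y})]\!]\cdot\boldsymbol{n}}{[\![\widehat{\boldsymbol{w}}]\!]^T[\![\widehat{\boldsymbol{z}}]\!]}$$ on the faces of elements in which the solution is constant, and $\boldsymbol{\mathcal{F}}^\dagger=\widetilde{\boldsymbol{\mathcal{F}}}^\dagger$ on the other faces; both elements adjacent to a face use the same flux. At face points with $[\![\boldsymbol{y}]\!]=0$ and $[\![\widehat{\boldsymbol{w}}]\!]=0$, $\beta=0$; otherwise the denominator of $\beta$ is assumed nonzero. (ii) Total-energy flux: $\mathcal{F}^\dagger_{\rho e_t}=\{\!\{\boldsymbol{\mathcal{F}}_{\rho e_t}(\boldsymbol{y})\}\!\}\cdot\boldsymbol{n}-\{\!\{\boldsymbol{w}^T\boldsymbol{\mathcal{F}}(\boldsymbol{y})\}\!\}\cdot\boldsymbol{n}+\{\!\{\boldsymbol{w}\}\!\}^T\boldsymbol{\mathcal{F}}^\dagger$.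 (iii) Residual: $$\widetilde{\boldsymbol{\mathcal{R}}}_k=\oint_{\partial\kappa}\phi_k\boldsymbol{\mathcal{F}}^\dagger ds-\int_\kappa\nabla\phi_k\cdot\boldsymbol{\mathcal{F}}(\boldsymbol{y})dx+\oint_{\partial\kappa}\phi_k\boldsymbol{\mathcal{D}}\,ds+\int_\kappa\phi_k\,\boldsymbol{\mathcal{B}}(\boldsymbol{y}):\nabla\boldsymbol{y}\,dx.$$ (iv) In an element where the solution is not constant: $\sum_j\mathcal{M}_{kj}\frac{d\widehat{\boldsymbol{y}}_j}{dt}+\widetilde{\boldsymbol{\mathcal{R}}}_k+\boldsymbol{r}_k=0$ with $\boldsymbol{r}_k=\alpha(\widehat{\boldsymbol{z}}_k-\overline{\boldsymbol{z}})$ and $$\alpha=\frac{\oint_{\partial\kappa}\mathcal{F}^\dagger_{\rho e_t}ds-\sum_k\widehat{\boldsymbol{w}}_k^T\widetilde{\boldsymbol{\mathcal{R}}}_k}{\sum_k(\widehat{\boldsymbol{w}}_k-\overline{\boldsymbol{w}})^T(\widehat{\boldsymbol{z}}_k-\overline{\boldsymbol{z}})},$$ the denominator being assumed nonzero. In an element where the solution is constant: $\sum_j\mathcal{M}_{kj}\frac{d\widehat{\boldsymbol{y}}_j}{dt}+\widetilde{\boldsymbol{\mathcal{R}}}_k=0$ (no elementwise correction). *)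

(* Defs.v *)
From HB Require Import structures.
From mathcomp Require Import all_boot all_order all_algebra.
From mathcomp Require mpoly.
From mathcomp Require Import all_classical all_reals all_analysis.
Set Implicit Arguments.
Unset Strict Implicit.
Unset Printing Implicit Defensive.
Import Order.TTheory GRing.Theory Num.Theory.
Import numFieldNormedType.Exports.
Import (canonicals, coercions) mpoly.
Local Open Scope classical_set_scope.
Local Open Scope ring_scope.

(* The measurable sets of R^d are those generated by the coordinates (the Borel
   sets), and lebesgue_rV is d-dimensional Lebesgue measure, built as an iterated
   product. *)
Section measurable_rV.
Context {R : realType} {d : nat}.
Let coor (i : 'I_d) (x : 'rV[R]_d) : measurableTypeR R := x ord0 i.
Let rV_set0 : g_sigma_preimage coor set0.
Proof. exact: sigma_algebra0. Qed.
Let rV_setC A : g_sigma_preimage coor A -> g_sigma_preimage coor (~` A).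
Proof. exact: sigma_algebraC. Qed.
Let rV_bigcup (F : _^nat) : (forall i, g_sigma_preimage coor (F i)) ->
  g_sigma_preimage coor (\bigcup_i (F i)).
Proof. exact: sigma_algebra_bigcup. Qed.

HB.instance Definition _ := @isMeasurable.Build default_measure_display
  'rV[R]_d (g_sigma_preimage coor) rV_set0 rV_setC rV_bigcup.
End measurable_rV.

Definition cons_rV {R : realType} {d} (p : R * 'rV[R]_d) : 'rV[R]_d.+1 :=
  row_mx p.1%:M p.2.

Lemma cons_rVl {R : realType} {d} (p : R * 'rV[R]_d) (j : 'I_1) :
  cons_rV p ord0 (lshift d j) = p.1.
Proof. by rewrite [LHS](row_mxEl p.1%:M p.2) mxE (ord1 j) eqxx. Qed.

Lemma cons_rVr {R : realType} {d} (p : R * 'rV[R]_d) (j : 'I_d) :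
  cons_rV p ord0 (rshift 1 j) = p.2 ord0 j.
Proof. exact: (row_mxEr p.1%:M p.2). Qed.

Section lebesgue_rV.
Context {R : realType}.

Fixpoint lebesgue_rV (d : nat) : set 'rV[R]_d -> \bar R :=
  match d with
  | 0%N => \d_(0 : 'rV[R]_0)
  | d'.+1 => pushforward (@lebesgue_measure R \x @lebesgue_rV d')%E cons_rV
  end.

Lemma measurable_coord_rV d (i : 'I_d) :
  measurable_fun [set: 'rV[R]_d] (fun x => x ord0 i : measurableTypeR R).
Proof.
move=> _ Y mY; rewrite setTI; apply: sub_sigma_algebra => /=.
rewrite -bigcup_seq/=; exists i => /=; first by rewrite mem_index_enum.
by exists Y => //; rewrite setTI.
Qed.

Lemma measurable_fun_rV d1 (T1 : measurableType d1) d (f : T1 -> 'rV[R]_d) :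
  (forall i, measurable_fun [set: T1] (fun x => f x ord0 i : measurableTypeR R)) ->
  measurable_fun [set: T1] f.
Proof.
move=> mf _ A mA; rewrite setTI.
suff : (fun B : set 'rV[R]_d => measurable (f @^-1` B)) A by [].
move: A mA; apply: smallest_sub.
  split => [|B mB|F mF].
  - by rewrite preimage_set0.
  - by rewrite setTD preimage_setC; apply: measurableC.
  - by rewrite preimage_bigcup; exact: bigcup_measurable.
rewrite -bigcup_seq => B [i _] [C mC <-]; rewrite /= setTI.
by have := mf i measurableT C mC; rewrite setTI.
Qed.

Lemma measurable_cons_rV d :
  measurable_fun [set: measurableTypeR R * 'rV[R]_d] (@cons_rV R d).
Proof.
apply: measurable_fun_rV => i.
have [j ij|j ij] := splitP (i : 'I_(1 + d)).
  have -> : i = lshift d j by exact/val_inj.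
  apply: (eq_measurable_fun fst) => // x _; exact/esym/cons_rVl.
have -> : i = rshift 1 j by exact/val_inj.
apply: (eq_measurable_fun ((fun x : 'rV[R]_d => x ord0 j : measurableTypeR R) \o snd)).
  by move=> x _; exact/esym/cons_rVr.
by apply: measurableT_comp => //; exact: measurable_coord_rV.
Qed.

Let box d (a : R) := [set x : 'rV[R]_d | forall i, -a <= x ord0 i <= a].

Let measurable_box d a : measurable (@box d a).
Proof.
rewrite (_ : @box d a = \bigcap_(i in [set: 'I_d])
   ((fun x : 'rV[R]_d => x ord0 i) @^-1` `[-a, a]%classic)).
  apply: fin_bigcap_measurable; first exact: finite_finset.
  move=> i _; rewrite -[X in measurable X]setTI.
  exact: (@measurable_coord_rV d i).
by apply/seteqP; split => x /= h i; have := h i; rewrite /= in_itv/=; auto.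
Qed.

Let sigma_finite_box d (mu : {measure set 'rV[R]_d -> \bar R}) :
  (forall a, (mu (@box d a) < +oo)%E) -> sigma_finite setT mu.
Proof.
move=> mu_box; exists (fun n => @box d n%:R).
  apply/esym/seteqP; split => // x _.
  have [k hk] : exists k : nat, forall i, `|x ord0 i| <= k%:R.
    exists (\sum_(i < d) Num.bound `|x ord0 i|)%N => i.
    apply: le_trans (ltW (archi_boundP _)) _; first exact: normr_ge0.
    by rewrite ler_nat (bigD1 i) //= leq_addr.
  by exists k => // i; rewrite -ler_norml.
by move=> k; split; [exact: measurable_box|exact: mu_box].
Qed.

Let lebesgue_rV_ax d : [/\ @lebesgue_rV d set0 = 0%E,
  (forall A, (0 <= @lebesgue_rV d A)%E), semi_sigma_additive (@lebesgue_rV d)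
  & forall a, (@lebesgue_rV d (@box d a) < +oo)%E].
Proof.
elim: d => [|d [mu0 mu_ge0 mu_sigma mu_box]].
  split => /=; [by rewrite measure0|by []|exact: measure_semi_sigma_additive|].
  by move=> a; rewrite diracE ltry.
pose mu0' := isMeasure.Build _ _ _ _ mu0 mu_ge0 mu_sigma.
pose muM : {measure set 'rV[R]_d -> \bar R} := HB.pack (@lebesgue_rV d) mu0'.
have sf : sigma_finite setT muM by exact: sigma_finite_box.
pose muS : {sigma_finite_measure set 'rV[R]_d -> \bar R} :=
  HB.pack (@lebesgue_rV d) mu0' (Measure_isSigmaFinite.Build _ _ _ _ sf).
pose nu := measure_function_pushforward__canonical__measure_function_Measure
  (@lebesgue_measure R \x muS)%E (@measurable_cons_rV d).
split => [|A||a].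
- exact: (@measure0 _ _ _ nu).
- exact: (@measure_ge0 _ _ _ nu).
- exact: (@measure_semi_sigma_additive _ _ _ nu).
rewrite /= /pushforward.
have -> : cons_rV @^-1` @box d.+1 a = `[-a, a]%classic `*` @box d a.
  apply/seteqP; split => [[x y] /= h|[x y] [/= hx hy] i].
    split.
    - have := h (lshift d (ord0 : 'I_1)).
      by rewrite cons_rVl /= in_itv.
    - move=> i; have := h (rshift 1 i).
      by rewrite cons_rVr.
  have [j ij|j ij] := splitP (i : 'I_(1 + d)).
    have -> : i = lshift d j by exact/val_inj.
    by rewrite cons_rVl; move: hx; rewrite /= in_itv.
  have -> : i = rshift 1 j by exact/val_inj.
  by rewrite cons_rVr.
rewrite (@product_measure1E _ _ _ _ _ lebesgue_measure muS) //.
  have Ifin : (@lebesgue_measure R `[(- a)%R, a]%classic < +oo)%E.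
    by rewrite lebesgue_measure_itv /=; case: ifP => _; rewrite -?EFinB ltry.
  rewrite lte_mul_pinfty ?measure_ge0 ?ge0_fin_numE //; last exact: mu_box.
exact: measurable_box.
Qed.

HB.instance Definition _ d := let: And4 mu0 mu_ge0 mu_sigma _ := lebesgue_rV_ax d in
  isMeasure.Build _ _ _ (@lebesgue_rV d) mu0 mu_ge0 mu_sigma.

HB.instance Definition _ d := Measure_isSigmaFinite.Build _ _ _ (@lebesgue_rV d)
  (sigma_finite_box (let: And4 _ _ _ mu_box := lebesgue_rV_ax d in mu_box)).

End lebesgue_rV.

Section vectors.
Context {R : realType}.

Definition dot {n} (a b : 'rV[R]_n) : R := \sum_i a ord0 i * b ord0 i.

Definition jump {V : zmodType} (a b : V) : V := a - b.

Definition avg {n} (a b : 'rV[R]_n) : 'rV[R]_n := 2^-1 *: (a + b).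

(* The oriented integral of f from a to b, for either order of a and b. *)
Definition oriented_integral (f : R -> R) (a b : R) : R :=
  if a <= b then \int[lebesgue_measure]_(x in `[a, b]) f x
  else - \int[lebesgue_measure]_(x in `[b, a]) f x.

Definition frontier {d} (A : set 'rV[R]_d) : set 'rV[R]_d :=
  closure A `\` interior A.

Definition peval {d} (q : mpoly.mpoly d R) (x : 'rV[R]_d) : R :=
  mpoly.meval (fun i => x ord0 i) q.

(* deg q <= p *)
Definition deg_le {d} (p : nat) (q : mpoly.mpoly d R) : Prop :=
  (mpoly.mmeasure mpoly.mdeg q <= p.+1)%N.

End vectors.

Record mixture (R : realType) (ns : nat) := Mixture {
  gasR : R;
  molar : 'I_ns -> R;
  href : 'I_ns -> R;
  Tref : R;
  cpp : 'I_ns -> {poly R};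
  gasR_gt0 : 0 < gasR;
  molar_gt0 : forall i, 0 < molar i }.

(* States are row vectors (rho v_1, .., rho v_d | P | C_1, .., C_ns). *)
Section thermodynamics.
Context {R : realType} {d ns : nat} (G : mixture R ns).
Local Notation state := 'rV[R]_(d + 1 + ns).
Implicit Types (y : state) (T : R).

Definition mk_state (a : 'I_d -> R) (b : R) (c : 'I_ns -> R) : state :=
  row_mx (row_mx (\row_k a k) b%:M) (\row_i c i).

Definition mom y (k : 'I_d) : R := y ord0 (lshift ns (lshift 1 k)).
Definition pres y : R := y ord0 (lshift ns (rshift d ord0)).
Definition conc y (i : 'I_ns) : R := y ord0 (rshift (d + 1) i).

Definition density y : R := \sum_i molar G i * conc y i.
Definition sumC y : R := \sum_i conc y i.
Definition vel y : 'rV[R]_d := \row_k (mom y k / density y).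
Definition temp y : R := pres y / (gasR G * sumC y).

Definition int_energy (i : 'I_ns) T : R :=
  href G i + oriented_integral (fun tau => (cpp G i).[tau]) (Tref G) T
  - gasR G / molar G i * T.

Definition rhoet y : R :=
  \sum_i molar G i * conc y i * int_energy i (temp y)
  + 2^-1 * density y * dot (vel y) (vel y).

Definition rhocp y : R := \sum_i molar G i * conc y i * (cpp G i).[temp y].
Definition rhocv y : R :=
  \sum_i molar G i * conc y i * ((cpp G i).[temp y] - gasR G / molar G i).
Definition heat_ratio y : R := rhocp y / rhocv y.
Definition sound2 y : R := heat_ratio y * pres y / density y.

(* The gradient of rho e_t in the conserved variables. Its closed form has the
   entries v_k, rho c_v / (R0 sum C), and
   W_i u_i - rho c_v P / (R0 (sum C)^2) - W_i (v . v) / 2. *)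
Definition wvar y : state := \row_j 'D_(delta_mx ord0 j) rhoet y.

Definition zvar y : state :=
  let g := conc (wvar y) in
  mk_state (fun k => vel y ord0 k * \sum_i molar G i * g i) (pres y) g.

(* Row k is the flux in the k-th coordinate direction. *)
Definition flux y : 'M[R]_(d, d + 1 + ns) :=
  \matrix_k mk_state
    (fun j => mom y j * vel y ord0 k + (if j == k then pres y else 0))
    (pres y * vel y ord0 k)
    (fun i => vel y ord0 k * conc y i).

Definition flux_et y : 'rV[R]_d := (rhoet y + pres y) *: vel y.

(* The vector w^T F(y), one entry per coordinate direction. *)
Definition wflux (w y : state) : 'rV[R]_d := \row_k dot w (row k (flux y)).

(* The vector B_{P,k}(y). *)
Definition Bvec y (k : 'I_d) : state :=
  ((density y * sound2 y - pres y) / density y) *: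
    mk_state (fun j => (j == k)%:R) 0 (fun i => - molar G i * vel y ord0 k).

(* B(y) : grad y, where row k of dy is the k-th partial derivative of y. *)
Definition Bgrad y (dy : 'M[R]_(d, d + 1 + ns)) : state :=
  mk_state (fun=> 0) (\sum_k dot (Bvec y k) (row k dy)) (fun=> 0).

Definition Dvec (n : 'rV[R]_d) (yp ym : state) : state :=
  mk_state (fun=> 0)
    (2^-1 * dot (\sum_k n ord0 k *: Bvec (avg yp ym) k) (ym - yp)) (fun=> 0).

End thermodynamics.

(* A mesh element is a bounded nonempty open set of finite perimeter in the
   sense of De Giorgi: gauss_green determines the measure n sigma on the
   frontier, hence, as |n| = 1, both sigma and (sigma-almost everywhere) n. For
   a Lipschitz or polyhedral domain these are the surface measure and the
   outward unit normal. Polynomial test functions suffice because they are dense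
   in the continuous functions on the compact frontier.
   The element carries a nodal basis phi of the polynomials of degree at most p
   (linear independence follows from phi_nodal) and a quadrature rule. *)
Record element (R : realType) (d p nb : nat) := Element {
  dom : set 'rV[R]_d;
  sigma : {finite_measure set 'rV[R]_d -> \bar R};
  normal : 'rV[R]_d -> 'rV[R]_d;
  phi : 'I_nb -> mpoly.mpoly d R;
  node : 'I_nb -> 'rV[R]_d;
  nq : nat;
  qpt : 'I_nq -> 'rV[R]_d;
  qwt : 'rV[R]_nq;
  dom_open : open dom;
  dom_bounded : bounded_set dom;
  dom_neq0 : dom !=set0;
  normal_measurable : measurable_fun (frontier dom) normal;
  normal_unit : forall x, frontier dom x -> dot (normal x) (normal x) = 1;
  gauss_green : forall (q : mpoly.mpoly d R) (k : 'I_d),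
    \int[@lebesgue_rV R d]_(x in dom) peval (mpoly.mderiv k q) x =
    \int[sigma]_(x in frontier dom) (peval q x * normal x ord0 k);
  phi_deg : forall j, deg_le p (phi j);
  phi_span : forall q, deg_le p q ->
    exists c : 'I_nb -> R, q = \sum_j c j *: phi j;
  phi_nodal : forall i j, peval (phi i) (node j) = (i == j)%:R;
  node_in : forall j, closure dom (node j);
  qpt_in : forall i, closure dom (qpt i) }.

Arguments qpt {R d p nb} e i.

Section discretization.
Context {R : realType} {d ns p nb : nat} (G : mixture R ns).
Local Notation state := 'rV[R]_(d + 1 + ns).
(* Row j is the j-th coefficient vector. *)
Local Notation coeffs := 'M[R]_(nb, d + 1 + ns).
Implicit Types (K : element R d p nb) (Y A : coeffs).

Definition mass K : 'M[R]_nb :=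
  \matrix_(i, j) \int[@lebesgue_rV R d]_(x in dom K)
     (peval (phi K i) x * peval (phi K j) x).

Definition Vq K : 'M[R]_(nq K, nb) := \matrix_(i, j) peval (phi K j) (qpt K i).

Definition proj_mx K : 'M[R]_(nb, nq K) :=
  invmx (mass K) *m (Vq K)^T *m diag_mx (qwt K).

Definition proj K (a : state -> state) Y : coeffs :=
  proj_mx K *m \matrix_i a (row i (Vq K *m Y)).

Definition interp K n (A : 'M[R]_(nb, n)) (x : 'rV[R]_d) : 'rV[R]_n :=
  (\row_j peval (phi K j) x) *m A.

Definition proj_reproduces_constants K : Prop :=
  forall (c : R) (x : 'rV[R]_d),
    interp K (proj_mx K *m (const_mx c : 'cV[R]_(nq K))) x = const_mx c.

(* Row k is the k-th partial derivative of the solution. *)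
Definition grad K Y (x : 'rV[R]_d) : 'M[R]_(d, d + 1 + ns) :=
  \matrix_k \sum_j peval (mpoly.mderiv k (phi K j)) x *: row j Y.

Definition mean_coeff A : state := nb%:R^-1 *: \sum_k row k A.

Definition is_constant K Y : Prop :=
  exists c, forall x, dom K x -> interp K Y x = c.

(* A mesh is a finite family K of elements, and Y gives the coefficients of the
   solution on every element. The face between e and e' is the common part of
   their frontiers. *)
Variables (E : finType) (K : E -> element R d p nb).

Definition face (e e' : E) : set 'rV[R]_d :=
  frontier (dom (K e)) `&` frontier (dom (K e')).

Definition disjoint_elements : Prop :=
  forall e e', e != e' -> dom (K e) `&` dom (K e') = set0.

(* All faces of e are interior: almost every frontier point lies on the face
   shared with exactly one other element. *)
Definition all_faces_interior (e : E) : Prop :=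
  {ae sigma (K e), forall x, frontier (dom (K e)) x ->
     exists! e', e' != e /\ frontier (dom (K e')) x}.

(* The integral over the frontier of e, summed over its faces; g e' is the
   integrand on the face shared with e'. *)
Definition surf_int (e : E) (g : E -> 'rV[R]_d -> R) : R :=
  \sum_(e' | e' != e) \int[sigma (K e)]_(x in face e e') g e' x.

(* lam e e' x is the wave speed estimate at the point x of the face. *)
Variables (lam : E -> E -> 'rV[R]_d -> R) (Y : E -> coeffs).

Definition sol e (x : 'rV[R]_d) : state := interp (K e) (Y e) x.
Definition what e : coeffs := proj (K e) (wvar G) (Y e).
Definition zhat e : coeffs := proj (K e) (zvar G) (Y e).
Definition wtr e (x : 'rV[R]_d) : state := interp (K e) (what e) x.
Definition ztr e (x : 'rV[R]_d) : state := interp (K e) (zhat e) x.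

(* Below, e is the interior (+) side of the face, and e' the exterior (-) side. *)
Definition LFflux e e' x : state :=
  normal (K e) x *m (2^-1 *: (flux G (sol e x) + flux G (sol e' x)))
  + (2^-1 * lam e e' x) *: jump (sol e x) (sol e' x).

Definition beta_den e e' x : R :=
  dot (jump (wtr e x) (wtr e' x)) (jump (ztr e x) (ztr e' x)).

Definition no_jump e e' x : bool :=
  (jump (sol e x) (sol e' x) == 0) && (jump (wtr e x) (wtr e' x) == 0).

Definition beta e e' x : R :=
  if no_jump e e' x then 0 else
  (- dot (jump (flux_et G (sol e x)) (flux_et G (sol e' x))) (normal (K e) x)
   - dot (jump (wtr e x) (wtr e' x)) (LFflux e e' x)
   + dot (jump (wflux G (wtr e x) (sol e x)) (wflux G (wtr e' x) (sol e' x)))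
         (normal (K e) x))
  / beta_den e e' x.

Definition corrected_face e e' : Prop :=
  is_constant (K e) (Y e) \/ is_constant (K e') (Y e').

Definition Fdag e e' x : state :=
  LFflux e e' x +
  (if `[< corrected_face e e' >] then
     beta e e' x *: jump (ztr e x) (ztr e' x) else 0).

Definition Fdag_et e e' x : R :=
  dot (avg (flux_et G (sol e x)) (flux_et G (sol e' x))) (normal (K e) x)
  - dot (avg (wflux G (wtr e x) (sol e x)) (wflux G (wtr e' x) (sol e' x)))
        (normal (K e) x)
  + dot (avg (wtr e x) (wtr e' x)) (Fdag e e' x).

(* Row k is the residual tested against phi_k. *)
Definition residual e : coeffs := \matrix_(k, i) (
  surf_int e (fun e' x => peval (phi (K e) k) x * Fdag e e' x ord0 i)
  - \int[@lebesgue_rV R d]_(x in dom (K e))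
      (\sum_l peval (mpoly.mderiv l (phi (K e) k)) x * flux G (sol e x) l i)
  + surf_int e (fun e' x => peval (phi (K e) k) x *
      Dvec G (normal (K e) x) (sol e x) (sol e' x) ord0 i)
  + \int[@lebesgue_rV R d]_(x in dom (K e))
      (peval (phi (K e) k) x *
       Bgrad G (sol e x) (grad (K e) (Y e) x) ord0 i)).

Definition alpha_den e : R :=
  \sum_k dot (row k (what e) - mean_coeff (what e))
             (row k (zhat e) - mean_coeff (zhat e)).

Definition alpha e : R :=
  (surf_int e (Fdag_et e) - \sum_k dot (row k (what e)) (row k (residual e)))
  / alpha_den e.

Definition correction e (k : 'I_nb) : state :=
  if `[< is_constant (K e) (Y e) >] then 0
  else alpha e *: (row k (zhat e) - mean_coeff (zhat e)).

Definition scheme_at e (dY : coeffs) : Prop :=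
  forall k, \sum_j mass (K e) k j *: row j dY + row k (residual e)
            + correction e k = 0.

Definition surface_integrable e : Prop :=
  forall e' k i, e' != e ->
    (sigma (K e)).-integrable (face e e')
      (fun x => (peval (phi (K e) k) x * Fdag e e' x ord0 i)%:E).

Definition beta_den_nonzero e : Prop :=
  forall e' x, e' != e -> corrected_face e e' -> face e e' x ->
    ~~ no_jump e e' x -> beta_den e e' x != 0.

Definition alpha_den_nonzero e : Prop :=
  ~ is_constant (K e) (Y e) -> alpha_den e != 0.

Definition uniform_PV (P0 : R) (v0 : 'rV[R]_d) : Prop :=
  forall e x, closure (dom (K e)) x ->
    pres (sol e x) = P0 /\ vel G (sol e x) = v0.

(* The second condition makes the temperature well defined. *)
Definition admissible : Prop :=
  forall e x, closure (dom (K e)) x ->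
    0 < density G (sol e x) /\ sumC (sol e x) != 0.

End discretization.

Definition ddt_coeffs {R : realType} {nb m : nat} (Y : R -> 'M[R]_(nb, m))
    (t : R) : 'M[R]_(nb, m) := \matrix_(j, i) derive1 (fun s => Y s j i) t.

(* Main.v *)
Require Import Defs.
From HB Require Import structures.
From mathcomp Require Import all_boot all_order all_algebra.
From mathcomp Require mpoly.
From mathcomp Require Import all_classical all_reals all_analysis.
From mathcomp Require Import measurable_realfun ring lra.
Import Order.TTheory GRing.Theory Num.Theory.
Import numFieldNormedType.Exports.
Import (canonicals, coercions) mpoly.
Set Implicit Arguments.
Unset Strict Implicit.
Unset Printing Implicit Defensive.
Local Open Scope classical_set_scope.
Local Open Scope ring_scope.

(** At constant pressure P0 and velocity v0 the flux is affine in the state: its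
    row in direction l is v0_l y + P0 (unit vector of the l-th momentum). The
    vectors B_k(y) are multiples of the slip modes, the linear forms
    y |-> rho v_k - v0_k rho, which vanish at every state of velocity v0; hence
    the nonconservative volume term and the jump term D both vanish
    (Bgrad_sol, Dvec_sol).

    Let a be a linear form on states that takes a constant value on the solution
    and a constant value on z(y). Then a F(y) is a constant vector b. Since the
    projection reproduces constants, the traces of z contribute no jump to
    a F^dag, so a F^dag = b.n whatever the size of the face correction, and the
    residual tested with a is the defect in the Gauss-Green formula for
    phi_k b, which is zero. The elementwise correction disappears too, since
    the coefficients of a z are all equal to their mean. The mass matrix is
    invertible (mass_unit), so a dy/dt = 0 (dot_ddt0). This applies to the
    pressure, and to the slip modes, on which z has been designed to vanish. A
    vanishing slip mode of dy/dt says that the velocity is stationary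
    (is_derive_vel0).

    For the energy, the chain rule turns the time derivative of rho e_t at a
    quadrature point into w . dy/dt, and the definition of the projection turns
    the quadrature sum of these into the pairing of w-hat with the mass matrix
    (quadrature_projection). In an element where the solution is not constant,
    alpha has been chosen to make this pairing equal to the outflow of total
    energy (dot_correction). In an element where it is constant, w-hat is a
    constant vector w, its pairing with the sum of the residuals over the
    partition of unity phi_k is the surface integral of w F^dag, and the choice of beta makes
    F^dag_et differ from w F^dag by a constant vector dotted with the normal
    (Fdag_et_corrected), whose surface integral is zero
    (constant_element_balance). *)

(** * Borel sets and Lebesgue measure in R^d *)

Section rV_measure.
Context {R : realType}.

(** The balls of the sup norm, written coordinatewise so that splitting off the
    first coordinate gives the product of an interval and a lower-dimensional
    cube. *)
Definition cube {d} (c : 'rV[R]_d) (r : R) : set 'rV[R]_d :=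
  [set x | forall i, `|x ord0 i - c ord0 i| < r].

Lemma measurable_cube d (c : 'rV[R]_d) r : measurable (cube c r).
Proof.
rewrite (_ : cube c r = \bigcap_(i in [set: 'I_d])
   ((fun x : 'rV[R]_d => x ord0 i) @^-1` ball (c ord0 i) r)).
  apply: fin_bigcap_measurable; first exact: finite_finset.
  move=> i _; rewrite -[X in measurable X]setTI.
  by apply: (@measurable_coord_rV R d i) => //; exact: measurable_ball.
apply/seteqP; split => x /= h i; last by rewrite distrC; exact: h.
by move=> _; rewrite /ball/= distrC; exact: h.
Qed.

Lemma cube_ball d (c : 'rV[R]_d) r : 0 < r -> cube c r = ball c r.
Proof.
move=> r0; apply/seteqP; split => [x h|x [_ h] i]; last by rewrite distrC; exact: h.
by split => // i j; rewrite (ord1 i) /ball/= distrC; exact: h.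
Qed.

(** The measurable sets are generated by the coordinates, so this rests on second
    countability: an open set is the union of the rational cubes it contains. *)
Lemma open_measurable_rV d (A : set 'rV[R]_d) : open A -> measurable A.
Proof.
move=> oA.
pose Q := ('rV[rat]_d * nat)%type.
pose box (q : Q) := cube (map_mx ratr q.1 : 'rV[R]_d) q.2.+1%:R^-1.
have -> : A = \bigcup_q (if `[< box q `<=` A >] then box q else set0).
  apply/seteqP; split => [x Ax|x [q _]]; last by case: asboolP => // h /h.
  have /nbhs_ballP[e /= e0 he] : nbhs x A by exact: open_nbhs_nbhs.
  (* A cube of radius h = 1/(n+1) < e/2 that contains x lies in the ball of radius
     e about x. *)
  pose n := Num.trunc (2 / e).
  have [n_e n0] : n.+1%:R^-1 < e / 2 /\ (0 : R) < n.+1%:R^-1.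
    by rewrite invr_gt0 invf_plt ?posrE ?divr_gt0// invf_div truncnS_gt.
  have [h hE] : {h : R | h = n.+1%:R^-1} by exists n.+1%:R^-1.
  rewrite -!hE in n_e n0.
  pose rx i := rat_in_itvoo (etrans (ltrDl (x ord0 i) h) n0).
  pose q : 'rV[rat]_d := \row_i sval (cid (rx i)).
  have qx i : `|x ord0 i - ratr (q ord0 i)| < h.
    rewrite mxE; case: cid => /= r; rewrite in_itv/= => /andP[xr rx'].
    by rewrite ltr_distlC; apply/andP; split; lra.
  clearbody q; exists (q, n) => //; case: asboolP => [_ i|].
    by rewrite /= -hE mxE; exact: qx.
  case=> y yq; apply: he; rewrite -cube_ball// => i.
  have := yq i; have := qx i; rewrite /= -hE mxE.
  by rewrite !ltr_distl => /andP[? ?] /andP[? ?]; apply/andP; split; lra.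
apply: countable_bigcupT_measurable; first exact: countableP.
by move=> q; case: asboolP => // _; exact: measurable_cube.
Qed.

Lemma lebesgue_rV_cube d (c : 'rV[R]_d) (r : R) : 0 < r ->
  @lebesgue_rV R d (cube c r) = ((r *+ 2) ^+ d)%:E.
Proof.
move=> r0; elim: d c => [|d ih] c.
  by rewrite /= diracE mem_set ?expr0//= => -[].
rewrite /= /pushforward.
have -> : cons_rV @^-1` cube c r =
    ball (c ord0 (lshift d (ord0 : 'I_1))) r `*` cube (\row_j c ord0 (rshift 1 j)) r.
  apply/seteqP; split => [[x y] /= h|[x y] [/= hx hy] i].
    split=> [|j /=]; rewrite ?mxE.
      by have := h (lshift d (ord0 : 'I_1)); rewrite cons_rVl /ball/= distrC.
    by have := h (rshift 1 j); rewrite cons_rVr.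
  have [j ij|j ij] := splitP (i : 'I_(1 + d)).
    have -> : i = lshift d j by exact/val_inj.
    by rewrite cons_rVl (ord1 j) distrC; exact: hx.
  have -> : i = rshift 1 j by exact/val_inj.
  by have := hy j; rewrite cons_rVr mxE.
rewrite (@product_measure1E _ _ _ _ _ lebesgue_measure (@lebesgue_rV R d)) //.
- rewrite exprS EFinM; congr (_ * _)%E; last exact: ih.
  exact: lebesgue_measure_ball (ltW r0).
- exact: measurable_ball.
- exact: measurable_cube.
Qed.

Lemma bounded_rV d (A : set 'rV[R]_d) : bounded_set A ->
  exists2 M, 0 < M & A `<=` cube 0 M.
Proof.
move=> [M [_ hM]]; exists (`|M| + 2); first by rewrite ltr_wpDl.
move=> x Ax i; rewrite mxE subr0.
have := hM (`|M| + 1) _ x Ax; rewrite ltr_pwDr ?ler_norm// => /(_ isT) /= h.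
rewrite (@le_lt_trans _ _ (`|M| + 1)) ?ltrD2l ?ltr1n//.
apply: le_trans h; rewrite [leRHS]/Num.Def.normr/= mx_normrE.
exact: (le_bigmax _ (fun ij : 'I_1 * 'I_d => `|x ij.1 ij.2|) (ord0, i)).
Qed.

Lemma lebesgue_rV_bounded d (A : set 'rV[R]_d) : measurable A -> bounded_set A ->
  (@lebesgue_rV R d A < +oo)%E.
Proof.
move=> mA /bounded_rV[M M0 AM].
apply: (@le_lt_trans _ _ (@lebesgue_rV R d (cube 0 M))).
  by apply: le_measure => //; rewrite inE//; exact: measurable_cube.
by rewrite lebesgue_rV_cube ?ltry.
Qed.

Lemma lebesgue_rV_open_gt0 d (A : set 'rV[R]_d) : open A -> A !=set0 ->
  (0 < @lebesgue_rV R d A)%E.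
Proof.
move=> oA [x Ax]; have /nbhs_ballP[e /= e0] := open_nbhs_nbhs (conj oA Ax).
rewrite -cube_ball// => eA.
apply: (@lt_le_trans _ _ (@lebesgue_rV R d (cube x e))).
  by rewrite lebesgue_rV_cube// lte_fin exprn_gt0// pmulrn_lgt0.
by apply: le_measure => //; rewrite inE; [exact: measurable_cube|exact: open_measurable_rV].
Qed.

Lemma frontier_measurable d (A : set 'rV[R]_d) : measurable (frontier A).
Proof.
apply: measurableD.
  rewrite -[closure A]setCK; apply: measurableC; apply: open_measurable_rV.
  exact/closed_openC/closed_closure.
by apply: open_measurable_rV; exact: open_interior.
Qed.

Lemma bounded_closure d (A : set 'rV[R]_d) : bounded_set A -> bounded_set (closure A).
Proof.
move=> [M [_ hM]]; exists (`|M| + 2); split=> [|K MK x clx]; first exact: num_real.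
have [y [Ay]] := clx _ (nbhsx_ballx x 1 ltr01).
rewrite -ball_normE /= => xy; have := hM (`|M| + 1) _ y Ay.
rewrite ltr_pwDr ?ler_norm// => /(_ isT) /= yM.
have := ler_normD (x - y) y; rewrite subrK; lra.
Qed.

End rV_measure.

(** * Polynomials as functions on R^d *)

Section polynomial_functions.
Context {R : realType} {d : nat}.
Implicit Types q : mpoly.mpoly d R.

Lemma pevalE q x : peval q x =
  \sum_(m <- mpoly.msupp q) mpoly.mcoeff m q * \prod_(i < d) x ord0 i ^+ (m i).
Proof. exact: mpoly.mevalE. Qed.

Lemma peval_continuous q : continuous (peval q).
Proof.
rewrite (funext (@pevalE q)).
apply: (@continuous_big _ _ +%R 0 xpredT); first exact: add_continuous.
move=> m _ x; apply: continuousM; first exact: cst_continuous.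
suff : continuous (fun x : 'rV[R]_d => \prod_(i < d) x ord0 i ^+ m i) by exact.
apply: (@continuous_big R 'I_d *%R 1 xpredT (@mul_continuous R) 'rV[R]_d).
move=> i _ y.
apply: (@continuous_comp _ _ _ (fun x : 'rV[R]_d => x ord0 i) (fun t => t ^+ _)).
  exact: coord_continuous.
exact: exprn_continuous.
Qed.

Lemma peval_measurable q (A : set 'rV[R]_d) :
  measurable A -> measurable_fun A (peval q).
Proof.
move=> mA; apply: (measurable_funS measurableT) => //.
rewrite (funext (@pevalE q)); apply: measurable_sum => m.
apply: measurable_funM; first exact: measurable_cst.
apply: measurable_prod => i _; apply: measurable_funX.
exact: measurable_coord_rV.
Qed.

Lemma peval_bounded q (A : set 'rV[R]_d) : bounded_set A ->
  [bounded peval q x | x in A].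
Proof.
move=> /bounded_rV[M M0 AM].
exists (\sum_(m <- mpoly.msupp q) `|mpoly.mcoeff m q| * \prod_(i < d) M ^+ (m i)).
split=> [|K MK x /AM xM]; first exact: num_real.
apply: le_trans (ltW MK); rewrite pevalE; apply: le_trans (ler_norm_sum _ _ _) _.
apply: ler_sum => m _; rewrite normrM normr_prod ler_wpM2l//.
apply: ler_prod => i _; rewrite normr_ge0 normrX/=.
have := xM i; rewrite mxE subr0 => /ltW xi.
by apply: lerXn2r => //; rewrite nnegrE ?normr_ge0 ?(ltW M0).
Qed.

Lemma peval_integrable (mu : {measure set 'rV[R]_d -> \bar R}) q
    (A : set 'rV[R]_d) :
  measurable A -> bounded_set A -> (mu A < +oo)%E ->
  mu.-integrable A (EFin \o peval q).
Proof.
move=> mA bA muA; apply: measurable_bounded_integrable => //.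
  exact: peval_measurable.
exact: peval_bounded.
Qed.

Lemma pevalZ_sum (I : Type) (r : seq I) (c : I -> R) (q : I -> mpoly.mpoly d R) x :
  peval (\sum_(j <- r) c j *: q j) x = \sum_(j <- r) c j * peval (q j) x.
Proof. by rewrite /peval raddf_sum; apply: eq_bigr => j _; exact: mpoly.mevalZ. Qed.

Lemma pevalM q1 q2 x : peval (q1 * q2) x = peval q1 x * peval q2 x.
Proof. exact: mpoly.mevalM. Qed.

Lemma pevalD q1 q2 x : peval (q1 + q2) x = peval q1 x + peval q2 x.
Proof. exact: mpoly.mevalD. Qed.

Lemma pevalZ c q x : peval (c *: q) x = c * peval q x.
Proof. exact: mpoly.mevalZ. Qed.

Lemma peval1 x : peval (1 : mpoly.mpoly d R) x = 1.
Proof. exact: mpoly.meval1. Qed.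

(** This carries what is known on an element to its boundary, where the nodes and
    the quadrature points may lie. *)
Lemma peval_closure q c (A : set 'rV[R]_d) :
  (forall x, A x -> peval q x = c) -> forall x, closure A x -> peval q x = c.
Proof.
move=> qA x clAx.
have cl : closed (peval q @^-1` [set c]).
  by apply: preimage_closed; [move=> y _; exact: peval_continuous|exact: closed_eq].
suff : closure (peval q @^-1` [set c]) x by rewrite -(closure_id _).1.
by apply: closureS clAx => y /qA.
Qed.

(** The square vanishes almost everywhere, and the open set where q is nonzero
    would have positive measure if it were nonempty. This makes the mass matrix
    positive definite. *)
Lemma peval_sqr_eq0 q (A : set 'rV[R]_d) : open A -> bounded_set A ->
  \int[@lebesgue_rV R d]_(x in A) peval (q * q) x = 0 ->
  forall x, A x -> peval q x = 0.
Proof.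
move=> oA bA q0 x Ax; apply: contrapT => /eqP qx.
have mA := open_measurable_rV oA.
have muA := lebesgue_rV_bounded mA bA.
have qi := peval_integrable (q * q) mA bA muA.
have : (\int[@lebesgue_rV R d]_(x in A) `|(peval (q * q) x)%:E|)%E = 0%E.
  rewrite -[LHS]fineK.
    congr EFin; rewrite -[RHS]q0; congr fine; apply: eq_integral => y _.
    by rewrite /= pevalM ger0_norm// -expr2 sqr_ge0.
  apply: integrable_fin_num => //; exact: integrable_abse.
move/(ae_eq_integral_abs _ mA).
case; first by apply/measurable_EFinP; exact: peval_measurable.
move=> N [mN N0 AN].
pose B := A `&` peval q @^-1` (~` [set 0]).
have oB : open B.
  apply: openI => //; apply: open_comp; first by move=> y _; exact: peval_continuous.
  by apply: closed_openC; exact: closed_eq.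
have : (0 < @lebesgue_rV R d B)%E.
  by apply: lebesgue_rV_open_gt0 => //; exists x; split => //; exact/eqP.
suff -> : @lebesgue_rV R d B = 0%E by rewrite ltxx.
apply: (subset_measure0 _ mN _ N0); first exact: open_measurable_rV.
move=> y [Ay qy]; apply: AN => /= /(_ Ay)[]; rewrite pevalM => /eqP.
by rewrite mulf_eq0 orbb => /eqP.
Qed.

End polynomial_functions.

(** * Integrals of finite linear combinations *)

Lemma RintegralZ_sum (R : realType) d (T : measurableType d) (mu : {measure set T -> \bar R})
    (D : set T) (I : Type) (r : seq I) (c : I -> R) (f : I -> T -> R) :
  measurable D -> (forall i, mu.-integrable D (EFin \o f i)) ->
  \int[mu]_(x in D) (\sum_(i <- r) c i * f i x) = \sum_(i <- r) c i * \int[mu]_(x in D) f i x.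
Proof.
move=> mD fint.
have cfint i : mu.-integrable D (fun x => (c i * f i x)%:E).
  exact: (integrableZl mD (c i) (fint i)).
rewrite /Rintegral; under eq_integral do rewrite -sumEFin.
rewrite integral_sum// -sum_fine; last by move=> i _; exact: integrable_fin_num.
by apply: eq_bigr => i _; rewrite -RintegralZl.
Qed.

Lemma integrableZ_sum (R : realType) d (T : measurableType d) (mu : {measure set T -> \bar R})
    (D : set T) (I : Type) (r : seq I) (c : I -> R) (f : I -> T -> R) :
  measurable D -> (forall i, mu.-integrable D (EFin \o f i)) ->
  mu.-integrable D (fun x => (\sum_(i <- r) c i * f i x)%:E).
Proof.
move=> mD fint; under eq_fun do rewrite -sumEFin.
by apply: integrable_sum => // i _; exact: (integrableZl mD (c i) (fint i)).
Qed.

(** * Nodal bases, the mass matrix and the projection *)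

Section element_theory.
Context {R : realType} {d p nb : nat} (K : element R d p nb).

Lemma dom_measurable : measurable (dom K).
Proof. by apply: open_measurable_rV; exact: dom_open. Qed.

Lemma frontier_closure (x : 'rV[R]_d) : frontier (dom K) x -> closure (dom K) x.
Proof. by case. Qed.

Lemma frontier_bounded : bounded_set (frontier (dom K)).
Proof.
have [M [Mr hM]] := bounded_closure (dom_bounded K).
by exists M; split => // N MN x [clx _]; exact: hM clx.
Qed.

Lemma peval_dom_integrable q :
  (@lebesgue_rV R d).-integrable (dom K) (EFin \o peval q).
Proof.
have mK := dom_measurable; have bK := dom_bounded K.
by apply: peval_integrable => //; exact: lebesgue_rV_bounded.
Qed.

Lemma normal_le1 x k : frontier (dom K) x -> `|normal K x ord0 k| <= 1.
Proof.
move=> /normal_unit n1; rewrite -(@expr_le1 _ 2)// real_normK ?num_real//.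
rewrite -n1 /dot (bigD1 k)//= -expr2 lerDl.
by apply: sumr_ge0 => i _; rewrite -expr2 sqr_ge0.
Qed.

Lemma peval_normal_integrable q k :
  (sigma K).-integrable (frontier (dom K))
    (EFin \o (fun x => peval q x * normal K x ord0 k)).
Proof.
have mF := frontier_measurable (dom K).
apply: measurable_bounded_integrable => //.
- by rewrite ltey_eq fin_num_measure.
- apply: measurable_funM; first exact: peval_measurable.
  apply: (measurableT_comp (measurable_coord_rV k)); exact: normal_measurable.
- have [M [Mr hM]] := peval_bounded q frontier_bounded.
  exists M; split => // N MN x Fx; rewrite /= normrM.
  rewrite -[leRHS]mulr1 ler_pM//; [exact: (hM _ MN)|exact: normal_le1].
Qed.

Lemma interpE n (A : 'M[R]_(nb, n)) x i :
  interp K A x ord0 i = \sum_j A j i * peval (phi K j) x.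
Proof. by rewrite /interp mxE; apply: eq_bigr => j _; rewrite mxE mulrC. Qed.

Lemma interp_peval n (A : 'M[R]_(nb, n)) x i :
  interp K A x ord0 i = peval (\sum_j A j i *: phi K j) x.
Proof. by rewrite interpE pevalZ_sum. Qed.

Lemma interp_row n (A : 'M[R]_(nb, n)) x :
  interp K A x = \sum_j peval (phi K j) x *: row j A.
Proof.
apply/rowP => i; rewrite interpE summxE; apply: eq_bigr => j _.
by rewrite !mxE mulrC.
Qed.

(** Coefficients are nodal values: an identity between solutions that holds on the
    closure of the element passes to their coefficients. *)
Lemma interp_node n (A : 'M[R]_(nb, n)) j : interp K A (node K j) = row j A.
Proof.
apply/rowP => i; rewrite interpE mxE (bigD1 j)//= phi_nodal eqxx mulr1.
by rewrite big1 ?addr0// => k kj; rewrite phi_nodal (negbTE kj) mulr0.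
Qed.

Lemma row_Vq n (A : 'M[R]_(nb, n)) i : row i (Vq K *m A) = interp K A (qpt K i).
Proof.
rewrite row_mul /interp; congr (_ *m _); apply/rowP => j; by rewrite !mxE.
Qed.

(** The constant 1 has degree 0, so it is a combination of the basis, with
    coefficients equal to its nodal values. *)
Lemma sum_phi x : \sum_j peval (phi K j) x = 1.
Proof.
have [c c1] : exists c : 'I_nb -> R, 1 = \sum_j c j *: phi K j.
  by apply: phi_span; rewrite /deg_le mpoly.mmeasure1.
have cE j : c j = 1.
  have := congr1 (peval ^~ (node K j)) c1; rewrite /= peval1 pevalZ_sum (bigD1 j)//=.
  rewrite phi_nodal eqxx mulr1 big1 ?addr0// => k kj.
  by rewrite phi_nodal (negbTE kj) mulr0.
rewrite -[RHS](peval1 x) c1 pevalZ_sum; apply: eq_bigr => j _.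
by rewrite cE mul1r.
Qed.

Lemma massE (u : 'I_nb -> R) i :
  \sum_j u j * mass K j i =
  \int[@lebesgue_rV R d]_(x in dom K) peval ((\sum_j u j *: phi K j) * phi K i) x.
Proof.
transitivity (\sum_j u j * \int[@lebesgue_rV R d]_(x in dom K) peval (phi K j * phi K i) x).
  apply: eq_bigr => j _; rewrite mxE; congr (_ * _).
  by apply: eq_Rintegral => x _; rewrite pevalM.
rewrite -RintegralZ_sum; last 2 first.
- exact: dom_measurable.
- by move=> j; exact: peval_dom_integrable.
apply: eq_Rintegral => x _; rewrite pevalM pevalZ_sum mulr_suml.
by apply: eq_bigr => j _; rewrite pevalM mulrA.
Qed.

Lemma mass_sym : (mass K)^T = mass K.
Proof.
by apply/matrixP => i j; rewrite !mxE; apply: eq_Rintegral => x _; rewrite mulrC.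
Qed.

(** A vector v in the kernel gives a polynomial q = sum_j v_j phi_j whose square
    has integral zero. It vanishes on the element, hence at the nodes, where its
    values are the v_j. *)
Lemma mass_unit : mass K \in unitmx.
Proof.
rewrite -row_free_unit; apply: inj_row_free => v vM.
pose q := \sum_j v ord0 j *: phi K j.
have q0 x : dom K x -> peval q x = 0.
  apply: peval_sqr_eq0 x; [exact: dom_open|exact: dom_bounded|].
  transitivity (\sum_i v ord0 i * (v *m mass K) ord0 i); last first.
    by rewrite vM big1// => i _; rewrite mxE mulr0.
  transitivity (\sum_i v ord0 i * \int[@lebesgue_rV R d]_(x in dom K) peval (q * phi K i) x).
    rewrite -RintegralZ_sum; last 2 first.
    - exact: dom_measurable.
    - by move=> j; exact: peval_dom_integrable.
    apply: eq_Rintegral => x _; rewrite pevalM [X in _ * X = _](pevalZ_sum _ (v ord0)).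
    by rewrite mulr_sumr; apply: eq_bigr => i _; rewrite pevalM mulrCA.
  by apply: eq_bigr => i _; congr (_ * _); rewrite mxE massE.
apply/rowP => j; rewrite mxE.
have := peval_closure q0 (@node_in _ _ _ _ K j); rewrite pevalZ_sum (bigD1 j)//=.
rewrite phi_nodal eqxx mulr1 big1 ?addr0// => k kj.
by rewrite phi_nodal (negbTE kj) mulr0.
Qed.

Lemma interp_closure n (A : 'M[R]_(nb, n)) c :
  (forall x, dom K x -> interp K A x = c) ->
  forall x, closure (dom K) x -> interp K A x = c.
Proof.
move=> Ac x clx; apply/rowP => i; rewrite interp_peval.
by apply: peval_closure clx => y Ky; rewrite -interp_peval Ac.
Qed.

(** Reproduction of constants is a statement on polynomials; evaluation at the
    nodes makes it one on coefficients. *)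
Lemma proj_const : proj_reproduces_constants K -> forall c,
  Defs.proj_mx K *m (const_mx c : 'cV[R]_(nq K)) = const_mx c.
Proof.
move=> Kproj c; apply/row_matrixP => j.
by rewrite -interp_node Kproj; apply/rowP => i; rewrite !mxE.
Qed.

End element_theory.

(** * Surface integrals and the Gauss-Green formula *)

Section surface_integrals.
Context {R : realType} {d p nb : nat} {E : finType} (K : E -> element R d p nb).
Variable e : E.

Lemma face_measurable e' : measurable (face K e e').
Proof. by apply: measurableI; exact: frontier_measurable. Qed.

Lemma eq_surf_int (g h : E -> 'rV[R]_d -> R) :
  (forall e' x, e' != e -> face K e e' x -> g e' x = h e' x) ->
  surf_int K e g = surf_int K e h.
Proof.
move=> gh; apply: eq_bigr => e' e'e; apply: eq_Rintegral => x.
by rewrite inE => /gh ->.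
Qed.

Lemma surf_intZ_sum (I : Type) (r : seq I) (c : I -> R) (g : I -> E -> 'rV[R]_d -> R) :
  (forall i e', e' != e -> (sigma (K e)).-integrable (face K e e') (EFin \o g i e')) ->
  surf_int K e (fun e' x => \sum_(i <- r) c i * g i e' x) =
  \sum_(i <- r) c i * surf_int K e (g i).
Proof.
move=> gint; under eq_bigr do rewrite mulr_sumr.
rewrite exchange_big; apply: eq_bigr => e' e'e /=.
rewrite RintegralZ_sum//; first exact: face_measurable.
by move=> i; exact: gint.
Qed.

Lemma surf_intB (g h : E -> 'rV[R]_d -> R) :
  (forall e', e' != e -> (sigma (K e)).-integrable (face K e e') (EFin \o g e')) ->
  (forall e', e' != e -> (sigma (K e)).-integrable (face K e e') (EFin \o h e')) ->
  surf_int K e (fun e' x => g e' x - h e' x) = surf_int K e g - surf_int K e h.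
Proof.
move=> gint hint; rewrite /surf_int -sumrB; apply: eq_bigr => e' e'e.
by rewrite RintegralB//; [exact: face_measurable|exact: gint|exact: hint].
Qed.

Lemma face_integrable (g : 'rV[R]_d -> R) e' :
  (sigma (K e)).-integrable (frontier (dom (K e))) (EFin \o g) ->
  (sigma (K e)).-integrable (face K e e') (EFin \o g).
Proof.
apply: integrableS; first exact: frontier_measurable.
- exact: face_measurable.
- exact: subIsetl.
Qed.

(** Almost every frontier point lies on exactly one face, so the indicators of the
    faces add up to 1 almost everywhere on the frontier. *)
Lemma surf_int_frontier (g : 'rV[R]_d -> R) :
  all_faces_interior K e ->
  (sigma (K e)).-integrable (frontier (dom (K e))) (EFin \o g) ->
  surf_int K e (fun=> g) = \int[sigma (K e)]_(x in frontier (dom (K e))) g x.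
Proof.
move=> Kint gint; set F := frontier (dom (K e)).
have mF : measurable F by exact: frontier_measurable.
pose r e' := g \_ (frontier (dom (K e'))).
have rint e' : (sigma (K e)).-integrable F (EFin \o r e').
  rewrite /r -restrict_EFin.
  have mF' := frontier_measurable (dom (K e')).
  by apply/(integrable_restrict _ mF' mF); exact: face_integrable.
have sumE x : \sum_(e' | e' != e) r e' x = \sum_e' (e' != e)%:R * r e' x.
  by rewrite big_mkcond; apply: eq_bigr => e' _; case: ifP; rewrite ?mul1r ?mul0r.
transitivity (\int[sigma (K e)]_(x in F) (\sum_(e' | e' != e) r e' x)).
  under eq_Rintegral do rewrite sumE.
  rewrite RintegralZ_sum// /surf_int big_mkcond; apply: eq_bigr => e' _.
  by case: ifP; rewrite ?mul1r ?mul0r// Rintegral_mkcondr.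
congr fine; apply: ae_eq_integral => //.
- under eq_fun do rewrite sumE.
  by apply: (measurable_int (sigma (K e))); exact: integrableZ_sum.
- exact: measurable_int gint.
apply: filterS Kint => x + Fx => /(_ Fx)[e' [[e'e Fe'] uniq_e']].
congr EFin; rewrite (bigD1 e')//= big1 ?addr0; last first.
  move=> e2 /andP[e2e e2e']; rewrite /r patchE memNset// => Fe2.
  by move: e2e'; rewrite (uniq_e' e2)// eqxx.
by rewrite /r patchE mem_set.
Qed.

Lemma green q k : all_faces_interior K e ->
  surf_int K e (fun _ x => peval q x * normal (K e) x ord0 k) =
  \int[@lebesgue_rV R d]_(x in dom (K e)) peval (mpoly.mderiv k q) x.
Proof.
move=> Kint; rewrite gauss_green surf_int_frontier//.
exact: peval_normal_integrable.
Qed.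

End surface_integrals.

(** * Antiderivatives of polynomials and the chain rule *)

Section differentiability.
Context {R : realType}.

Definition antiderivative (q : {poly R}) : {poly R} :=
  \poly_(i < (size q).+1) (q`_i.-1 / i%:R).

Lemma antiderivativeK (q : {poly R}) : (antiderivative q)^`() = q.
Proof.
apply/polyP => i; rewrite coef_deriv coef_poly ltnS.
have [qi|iq] := ltnP i (size q); last by rewrite mul0rn nth_default.
by rewrite /= -[LHS]mulr_natr divfK// pnatr_eq0.
Qed.

Lemma integral_horner (q : {poly R}) a b : a <= b ->
  \int[lebesgue_measure]_(x in `[a, b]) q.[x] =
  (antiderivative q).[b] - (antiderivative q).[a].
Proof.
rewrite le_eqVlt => /predU1P[->|ab]; first by rewrite set_itv1 Rintegral_set1 subrr.
rewrite /Rintegral (continuous_FTC2 ab (F := horner (antiderivative q)))//=.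
- by apply: continuous_subspaceT => x; exact: continuous_horner.
- split => [x _| |]; first exact: derivable_horner.
  + by apply: cvg_at_right_filter; exact: continuous_horner.
  + by apply: cvg_at_left_filter; exact: continuous_horner.
- by move=> x _; rewrite -derivE antiderivativeK.
Qed.

(** With an explicit antiderivative, the enthalpy becomes a polynomial of the
    temperature, and no differentiation of an integral is left. *)
Lemma oriented_integral_horner (q : {poly R}) a b :
  oriented_integral (horner q) a b = (antiderivative q).[b] - (antiderivative q).[a].
Proof.
rewrite /oriented_integral; case: leP => [|/ltW] ab; first exact: integral_horner.
by rewrite integral_horner// opprB.
Qed.

Lemma differentiable_bigsum (V : normedModType R) n (f : 'I_n -> V -> R) y :
  (forall i, differentiable (f i) y) -> differentiable (fun z => \sum_i f i z) y.
Proof.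
move=> fy; have := differentiable_sum fy; rewrite fct_sumE; exact.
Qed.

(** The partial derivatives of f suffice because f is differentiable in the
    Frechet sense. *)
Lemma chain_rule_rV n (f : 'rV[R]_n -> R) (Z : R -> 'rV[R]_n) t :
  differentiable f (Z t) -> (forall i, derivable (fun s => Z s ord0 i) t 1) ->
  derivable (f \o Z) t 1 /\
  derive1 (f \o Z) t =
    \sum_i 'D_(delta_mx ord0 i) f (Z t) * derive1 (fun s => Z s ord0 i) t.
Proof.
move=> fZ dZ.
have dZ' : derivable Z t 1 by apply/derivable_mxP => i j; rewrite (ord1 i).
have diffZ : differentiable Z t by exact/derivable1_diffP.
have diffZf : differentiable (f \o Z) t by exact: differentiable_comp.
split; first exact/derivable1_diffP.
rewrite derive1E deriveE// diff_comp//= -[X in _ X = _](deriveE _ diffZ) derive_mx//.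
rewrite [X in 'd f _ X]row_sum_delta linear_sum; apply: eq_bigr => i _.
by rewrite linearZ /= mxE derive1E [X in _ = X * _]deriveE//; exact: mulrC.
Qed.

End differentiability.

(** * Differentiability of the total energy *)

Section thermo_differentiability.
Context {R : realType} {d ns : nat} (G : mixture R ns).
Local Notation state := 'rV[R]_(d + 1 + ns).
Implicit Types y : state.

Lemma int_energy_poly i : exists P : {poly R}, int_energy G i = horner P.
Proof.
pose Q := antiderivative (cpp G i).
exists ((href G i)%:P + (Q - Q.[Tref G]%:P) - (gasR G / molar G i) *: 'X).
by apply/funext => T; rewrite /int_energy oriented_integral_horner !hornerE.
Qed.

Lemma differentiable_density y : differentiable (density G) y.
Proof.
apply: differentiable_bigsum => i.
apply: (@differentiableZ _ _ _ (fun y => conc y i)); exact: differentiable_coord.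
Qed.

Lemma differentiable_temp y : sumC y != 0 -> differentiable (@temp R d ns G) y.
Proof.
move=> Cy; have Rn0 : gasR G != 0 by rewrite gt_eqF// gasR_gt0.
apply: (@differentiableM _ _ (@pres R d ns)); first exact: differentiable_coord.
apply: differentiableV; last by rewrite mulf_neq0.
apply: (@differentiableZ _ _ _ (@sumC R d ns)).
by apply: differentiable_bigsum => i; exact: differentiable_coord.
Qed.

Lemma differentiable_rhoet y : density G y != 0 -> sumC y != 0 ->
  differentiable (@rhoet R d ns G) y.
Proof.
move=> ry Cy.
have dvel k : differentiable (fun y => vel G y ord0 k) y.
  rewrite (_ : (fun y => _) = (fun y : state => mom y k / density G y)); last first.
    by apply/funext => z; rewrite mxE.
  apply: (@differentiableM _ _ (fun z : state => mom z k)).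
    exact: differentiable_coord.
  by apply: differentiableV => //; exact: differentiable_density.
apply: differentiableD.
  apply: differentiable_bigsum => i.
  apply: (@differentiableM _ _ (fun y => molar G i * conc y i)).
    apply: (@differentiableZ _ _ _ (fun y => conc y i)); exact: differentiable_coord.
  have [P ->] := int_energy_poly i.
  apply: (@differentiable_comp _ _ _ _ (@temp R d ns G)).
    exact: differentiable_temp.
  exact/derivable1_diffP/derivable_horner.
apply: (@differentiableM _ _ (fun y => 2^-1 * density G y)).
  apply: (@differentiableZ _ _ _ (density G)); exact: differentiable_density.
by apply: differentiable_bigsum => k; exact: differentiableM.
Qed.

End thermo_differentiability.

(** * The Euclidean inner product *)

Section dot_theory.
Context {R : realType} {n : nat}.
Implicit Types a b c : 'rV[R]_n.

Lemma dotC a b : dot a b = dot b a.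
Proof. by apply: eq_bigr => i _; rewrite mulrC. Qed.

Lemma dotDr a b c : dot a (b + c) = dot a b + dot a c.
Proof. by rewrite /dot -big_split; apply: eq_bigr => i _; rewrite mxE mulrDr. Qed.

Lemma dotZr a k b : dot a (k *: b) = k * dot a b.
Proof. by rewrite /dot mulr_sumr; apply: eq_bigr => i _; rewrite mxE mulrCA. Qed.

Lemma dotBr a b c : dot a (b - c) = dot a b - dot a c.
Proof. by rewrite dotDr -scaleN1r dotZr mulN1r. Qed.

Lemma dot0r a : dot a 0 = 0.
Proof. by rewrite -[X in dot _ X](scale0r a) dotZr mul0r. Qed.

Lemma dot_sumr (I : Type) (r : seq I) (P : pred I) a (b : I -> 'rV[R]_n) :
  dot a (\sum_(i <- r | P i) b i) = \sum_(i <- r | P i) dot a (b i).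
Proof. by apply: (big_morph (dot a)) => [x y|]; [exact: dotDr|exact: dot0r]. Qed.

Lemma dotBl a b c : dot (a - b) c = dot a c - dot b c.
Proof. by rewrite dotC dotBr !(dotC c). Qed.

Lemma dotZl k a b : dot (k *: a) b = k * dot a b.
Proof. by rewrite dotC dotZr dotC. Qed.

Lemma dot0l a : dot 0 a = 0.
Proof. by rewrite dotC dot0r. Qed.

Lemma dot_suml (I : Type) (r : seq I) (P : pred I) a (b : I -> 'rV[R]_n) :
  dot (\sum_(i <- r | P i) b i) a = \sum_(i <- r | P i) dot (b i) a.
Proof. by rewrite dotC dot_sumr; apply: eq_bigr => i _; exact: dotC. Qed.

Lemma dot_delta i a : dot (delta_mx ord0 i) a = a ord0 i.
Proof.
rewrite /dot (bigD1 i)//= mxE !eqxx mul1r big1 ?addr0// => j ji.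
by rewrite mxE (negbTE ji) andbF mul0r.
Qed.

Lemma dot_mulmx d (m : 'rV[R]_d) a (A : 'M[R]_(d, n)) :
  dot a (m *m A) = \sum_l m ord0 l * dot a (row l A).
Proof. by rewrite mulmx_sum_row dot_sumr; apply: eq_bigr => l _; rewrite dotZr. Qed.

Lemma dot_avg a b c : dot c (avg a b) = 2^-1 * (dot c a + dot c b).
Proof. by rewrite /avg dotZr dotDr. Qed.

End dot_theory.

(** * States of given pressure and velocity *)

Section equilibrium_states.
Context {R : realType} {d ns : nat} (G : mixture R ns).
Local Notation state := 'rV[R]_(d + 1 + ns).
Implicit Types y z : state.

Lemma mom_mk a b c k : mom (mk_state a b c : state) k = a k.
Proof. by rewrite /mom /mk_state !row_mxEl mxE. Qed.

Lemma pres_mk a b c : pres (mk_state a b c : state) = b.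
Proof. by rewrite /pres /mk_state row_mxEl row_mxEr mxE mulr1n. Qed.

Lemma conc_mk a b c i : conc (mk_state a b c : state) i = c i.
Proof. by rewrite /conc /mk_state row_mxEr mxE. Qed.

Definition mk_stateE := (mom_mk, pres_mk, conc_mk).

Lemma state_ext y z : (forall k, mom y k = mom z k) -> pres y = pres z ->
  (forall i, conc y i = conc z i) -> y = z.
Proof.
move=> myz pyz cyz; apply/rowP => j.
have [j1 jE|i iE] := splitP j; last first.
  have -> : j = rshift (d + 1) i by exact/val_inj.
  exact: cyz.
have [k kE|o oE] := splitP j1.
  have -> : j = lshift ns (lshift 1 k) by apply/val_inj; rewrite /= jE.
  exact: myz.
have -> : j = lshift ns (rshift d ord0) by apply/val_inj; rewrite /= jE oE (ord1 o).
exact: pyz.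
Qed.

Lemma dot_state y z : dot y z =
  \sum_k mom y k * mom z k + pres y * pres z + \sum_i conc y i * conc z i.
Proof. by rewrite /dot big_split_ord/= big_split_ord/= big_ord1. Qed.

(** The linear form z |-> (rho v_k)(z) - v_k rho(z). By the velocity evolution
    equation, its value at dy/dt is rho times the time derivative of v_k; and it
    is the direction of the vector B_k. *)
Definition slip_mode (v : 'rV[R]_d) (k : 'I_d) : state :=
  mk_state (fun j => (j == k)%:R) 0 (fun i => - molar G i * v ord0 k).

Lemma dot_slip v k z : dot (slip_mode v k) z = mom z k - v ord0 k * density G z.
Proof.
rewrite dot_state (bigD1 k)//= !mk_stateE eqxx mul1r mul0r addr0 big1 ?addr0.
  congr (_ + _); rewrite /density mulr_sumr -sumrN; apply: eq_bigr => i _.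
  by rewrite mk_stateE; ring.
by move=> j jk; rewrite mk_stateE (negbTE jk) mul0r.
Qed.

Definition pres_mode : state := delta_mx ord0 (lshift ns (rshift d ord0)).

Lemma dot_pres z : dot pres_mode z = pres z.
Proof. exact: dot_delta. Qed.

Definition mom_unit k : state := delta_mx ord0 (lshift ns (lshift 1 k)).

Lemma BvecE y k : Bvec G y k =
  ((density G y * sound2 G y - pres y) / density G y) *: slip_mode (vel G y) k.
Proof. by []. Qed.

Variables (P0 : R) (v0 : 'rV[R]_d).

Definition equilibrium y := [/\ 0 < density G y, pres y = P0 & vel G y = v0].

Lemma mom_equilibrium y k : equilibrium y -> mom y k = v0 ord0 k * density G y.
Proof. by case=> r0 _ <-; rewrite mxE divfK// gt_eqF. Qed.

Lemma dot_slip_equilibrium y k : equilibrium y -> dot (slip_mode v0 k) y = 0.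
Proof. by move=> y0; rewrite dot_slip (mom_equilibrium _ y0) subrr. Qed.

(** At fixed pressure and velocity the flux is affine in the state; this is the
    reason why fluxes of equilibrium states are polynomials and why linear forms
    constant on the solution are constant on the flux. *)
Lemma flux_equilibrium y l : equilibrium y ->
  row l (flux G y) = v0 ord0 l *: y + P0 *: mom_unit l.
Proof.
move=> [_ yP yv]; have -> : row l (flux G y) = mk_state
    (fun j => mom y j * vel G y ord0 l + (if j == l then pres y else 0))
    (pres y * vel G y ord0 l) (fun i => vel G y ord0 l * conc y i).
  by apply/rowP => j; rewrite !mxE.
rewrite yP yv; apply: state_ext => [j||i]; rewrite mk_stateE /mom /pres /conc !mxE.
- rewrite mulrC; congr (_ + _); rewrite /= !(inj_eq (@lshift_inj _ _)).
  by case: eqVneq; rewrite ?mulr1 ?mulr0.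
- by rewrite /= (inj_eq (@lshift_inj _ _)) eq_rlshift mulr0 addr0 -/(pres y) yP mulrC.
- by rewrite /= eq_rlshift mulr0 addr0.
Qed.

(** Momentum and density are proportional with the same factor v0 on both sides,
    so averaging keeps the velocity. *)
Lemma avg_equilibrium y z : equilibrium y -> equilibrium z -> equilibrium (avg y z).
Proof.
move=> y0 z0; have [ry yP yv] := y0; have [rz zP zv] := z0.
have rE : density G (avg y z) = 2^-1 * (density G y + density G z).
  rewrite /density -big_split mulr_sumr; apply: eq_bigr => i _ /=.
  by rewrite /conc /avg !mxE; ring.
have r0 : 0 < density G (avg y z) by rewrite rE mulr_gt0// addr_gt0.
split => //.
  by rewrite /pres /avg !mxE -/(pres y) -/(pres z) yP zP; lra.
apply/rowP => k; rewrite mxE; apply: (canLR (mulfK _)); first by rewrite gt_eqF.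
rewrite rE /avg /mom !mxE -/(mom y k) -/(mom z k).
by rewrite (mom_equilibrium k y0) (mom_equilibrium k z0); ring.
Qed.

(** The vector B is evaluated at the average, whose velocity is again v0, so it
    pairs with both traces to zero. *)
Lemma Dvec_equilibrium n y z : equilibrium y -> equilibrium z -> Dvec G n y z = 0.
Proof.
move=> y0 z0; have [_ _ av] := avg_equilibrium y0 z0.
rewrite /Dvec dot_suml big1 => [|k _].
  by apply: state_ext => *; rewrite mk_stateE ?mulr0 /mom /pres /conc mxE.
by rewrite dotZl BvecE av dotZl dotBr !dot_slip_equilibrium// subrr !mulr0.
Qed.

Lemma Bgrad_equilibrium y (dy : 'M[R]_(d, d + 1 + ns)) : equilibrium y ->
  (forall k, dot (slip_mode v0 k) (row k dy) = 0) -> Bgrad G y dy = 0.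
Proof.
move=> [_ _ yv] dy0; rewrite /Bgrad big1 => [|k _].
  by apply: state_ext => *; rewrite mk_stateE /mom /pres /conc mxE.
by rewrite BvecE yv dotZl dy0 mulr0.
Qed.

(** The momentum components of z are chosen for this cancellation, so that the
    corrections leave the velocity alone. *)
Lemma dot_slip_zvar y k : equilibrium y -> dot (slip_mode v0 k) (zvar G y) = 0.
Proof.
move=> [_ _ yv]; rewrite dot_slip /zvar mk_stateE yv; apply/eqP.
by rewrite subr_eq0; apply/eqP; congr (_ * _); apply: eq_bigr => i _; rewrite mk_stateE.
Qed.

Lemma pres_zvar y : equilibrium y -> pres (zvar G y) = P0.
Proof. by case=> _ yP _; rewrite /zvar mk_stateE. Qed.

End equilibrium_states.

(** * Linear forms conserved by the scheme at equilibrium *)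

Section scheme_at_equilibrium.
Context {R : realType} {d ns p nb : nat} (G : mixture R ns).
Context {E : finType} (K : E -> element R d p nb).
Local Notation state := 'rV[R]_(d + 1 + ns).
Local Notation coeffs := 'M[R]_(nb, d + 1 + ns).
Variables (lam : E -> E -> 'rV[R]_d -> R) (Y : E -> coeffs).
Variables (P0 : R) (v0 : 'rV[R]_d) (e : E).

Hypothesis Kproj : forall e', proj_reproduces_constants (K e').
Hypothesis e_interior : all_faces_interior K e.
Hypothesis Yeq : forall e' x, closure (dom (K e')) x -> equilibrium G P0 v0 (sol K Y e' x).
Hypothesis Fint : surface_integrable G K lam Y e.

Local Notation y := (sol K Y).
Local Notation F := (Fdag G K lam Y e).
Local Notation n := (normal (K e)).
Local Notation phi_ k := (peval (phi (K e) k)).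

Let dom_eq x : dom (K e) x -> equilibrium G P0 v0 (y e x).
Proof. by move=> Kx; apply: Yeq; exact: subset_closure. Qed.

Let face_eq e' x : face K e e' x ->
  equilibrium G P0 v0 (y e x) /\ equilibrium G P0 v0 (y e' x).
Proof. by move=> [] /frontier_closure ? /frontier_closure ?; split; exact: Yeq. Qed.

Lemma row_equilibrium j : equilibrium G P0 v0 (row j (Y e)).
Proof. by rewrite -(interp_node (K e)); apply: Yeq; exact: node_in. Qed.

(** The slip modes vanish on the nodal values, hence on the coefficients, hence on
    every derivative of the solution. *)
Lemma Bgrad_sol x : dom (K e) x -> Bgrad G (y e x) (grad (K e) (Y e) x) = 0.
Proof.
move=> Kx; apply: (Bgrad_equilibrium (dom_eq Kx)) => k.
rewrite rowK dot_sumr big1// => j _.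
by rewrite dotZr (dot_slip_equilibrium _ (row_equilibrium j)) mulr0.
Qed.

Lemma Dvec_sol e' x : face K e e' x -> Dvec G (n x) (y e x) (y e' x) = 0.
Proof. by move=> /face_eq[]; exact: Dvec_equilibrium. Qed.

(** On the element the integrand agrees with a polynomial. *)
Lemma flux_component_integrable k i :
  (@lebesgue_rV R d).-integrable (dom (K e)) (EFin \o (fun x =>
    \sum_l peval (mpoly.mderiv l (phi (K e) k)) x * flux G (y e x) l i)).
Proof.
pose c l := P0 * (mom_unit l : state) ord0 i.
pose q := \sum_l 1 *: (mpoly.mderiv l (phi (K e) k) *
  (v0 ord0 l *: (\sum_j Y e j i *: phi (K e) j) + c l *: 1)).
apply: (eq_integrable (dom_measurable (K e)) (EFin \o peval q)); last first.
  exact: peval_dom_integrable.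
move=> x; rewrite inE => Kx; congr EFin; rewrite pevalZ_sum; apply: eq_bigr => l _.
rewrite mul1r pevalM; congr (_ * _); rewrite pevalD !pevalZ peval1 mulr1.
have -> : flux G (y e x) l i = row l (flux G (y e x)) ord0 i by rewrite [RHS]mxE.
by rewrite (flux_equilibrium l (dom_eq Kx)) [RHS]mxE [X in _ = X + _]mxE
  [X in _ = _ + X]mxE -interp_peval.
Qed.

Lemma dot_residual a k :
  dot a (row k (residual G K lam Y e)) =
  surf_int K e (fun e' x => phi_ k x * dot a (F e' x)) -
  \int[@lebesgue_rV R d]_(x in dom (K e))
    (\sum_l peval (mpoly.mderiv l (phi (K e) k)) x * dot a (row l (flux G (y e x)))).
Proof.
have surf0 (g : E -> 'rV[R]_d -> R) :
    (forall e' x, e' != e -> face K e e' x -> g e' x = 0) -> surf_int K e g = 0.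
  move=> /eq_surf_int ->; rewrite /surf_int big1// => e' _.
  by rewrite /Rintegral integral0.
have resE i : residual G K lam Y e k i =
  surf_int K e (fun e' x => phi_ k x * F e' x ord0 i) -
  \int[@lebesgue_rV R d]_(x in dom (K e))
    (\sum_l peval (mpoly.mderiv l (phi (K e) k)) x * flux G (y e x) l i).
  rewrite mxE [X in _ + X + _]surf0 ?addr0; last first.
    by move=> e' x _ xf; rewrite Dvec_sol// mxE mulr0.
  rewrite [X in _ + X](_ : _ = 0) ?addr0//.
  rewrite (@eq_Rintegral _ _ _ _ _ (cst 0)); first by rewrite /Rintegral integral0.
  by move=> x; rewrite inE => Kx; rewrite Bgrad_sol// mxE mulr0.
rewrite /dot; under eq_bigr do rewrite mxE resE mulrBr.
rewrite sumrB; congr (_ - _).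
  rewrite -surf_intZ_sum; last by move=> i e' e'e; exact: Fint.
  apply: eq_surf_int => e' x _ _; rewrite /dot mulr_sumr.
  by apply: eq_bigr => i _; rewrite mulrCA.
rewrite -RintegralZ_sum; last 2 first.
- exact: dom_measurable.
- by move=> i; exact: flux_component_integrable.
apply: eq_Rintegral => x _; under eq_bigr do rewrite mulr_sumr.
rewrite exchange_big; apply: eq_bigr => l _; rewrite /dot mulr_sumr.
by apply: eq_bigr => i _; rewrite [row _ _ _ _]mxE mulrCA.
Qed.

(** A constant flux leaves only boundary terms, by the Gauss-Green formula. *)
Lemma dot_residual_const a (b : 'I_d -> R) k :
  (forall l x, dom (K e) x -> dot a (row l (flux G (y e x))) = b l) ->
  dot a (row k (residual G K lam Y e)) =
  surf_int K e (fun e' x => phi_ k x * dot a (F e' x)) -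
  surf_int K e (fun _ x => \sum_l b l * (phi_ k x * n x ord0 l)).
Proof.
move=> ab; rewrite dot_residual; congr (_ - _).
rewrite (@surf_intZ_sum _ _ _ _ _ K e _ _ b (fun l _ x => phi_ k x * n x ord0 l)); last first.
  by move=> l e' _; apply: face_integrable; exact: peval_normal_integrable.
under [RHS]eq_bigr do rewrite green//.
rewrite -RintegralZ_sum; last 2 first.
- exact: dom_measurable.
- by move=> i; exact: peval_dom_integrable.
apply: eq_Rintegral => x; rewrite inE => Kx.
by apply: eq_bigr => l _; rewrite ab// mulrC.
Qed.

(** A linear form acts on the values of g before projection as well as on the
    coefficients after it, and constants are reproduced. *)
Lemma row_proj_const e' (g : state -> state) a c :
  (forall x, closure (dom (K e')) x -> dot a (g (y e' x)) = c) ->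
  forall k, dot a (row k (Defs.proj (K e') g (Y e'))) = c.
Proof.
move=> gc k.
have dotM m (A : 'M[R]_(m, d + 1 + ns)) j : dot a (row j A) = (A *m a^T) j ord0.
  by rewrite mxE /dot; apply: eq_bigr => i _; rewrite !mxE mulrC.
rewrite dotM /Defs.proj -mulmxA.
rewrite [X in _ *m X](_ : _ = const_mx c); first by rewrite proj_const// mxE.
apply/matrixP => i j; rewrite (ord1 j) -dotM rowK mxE row_Vq.
by apply: gc; exact: qpt_in.
Qed.

Lemma dot_ztr a c e' x : (forall x, closure (dom (K e')) x -> dot a (zvar G (y e' x)) = c) ->
  dot a (ztr G K Y e' x) = c.
Proof.
move=> ac; rewrite /ztr interp_row dot_sumr.
under eq_bigr do rewrite dotZr (row_proj_const ac).
by rewrite -mulr_suml sum_phi mul1r.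
Qed.

(** The linear forms a below are constant on the solution and on z. They do not
    see the correction terms, whose directions are differences of values of z. *)
Section balanced_mode.
Variables (a : state) (s c : R).
Hypothesis a_sol : forall e' x, closure (dom (K e')) x -> dot a (y e' x) = s.
Hypothesis a_zvar :
  forall e' x, closure (dom (K e')) x -> dot a (zvar G (y e' x)) = c.

(** The numerical flux is consistent and a sees no jump, so a F^dag = b.n is the
    exact boundary flux of the constant vector b. *)
Lemma dot_residual0 k : dot a (row k (residual G K lam Y e)) = 0.
Proof.
pose b l := v0 ord0 l * s + P0 * dot a (mom_unit l : state).
have ab l e' x : closure (dom (K e')) x -> dot a (row l (flux G (y e' x))) = b l.
  move=> clx; rewrite (flux_equilibrium l (Yeq clx)).
  by rewrite dotDr !dotZr a_sol.
rewrite (@dot_residual_const _ b); last first.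
  by move=> l x Kx; apply: ab; exact: subset_closure.
apply/eqP; rewrite subr_eq0; apply/eqP; apply: eq_surf_int => e' x _ xf.
have [/frontier_closure clx /frontier_closure clx'] := xf.
have -> : dot a (F e' x) = \sum_l n x ord0 l * b l.
  rewrite /Fdag dotDr [X in _ + X](_ : _ = 0) ?addr0; last first.
    case: asboolP => _; last by rewrite dot0r.
    rewrite dotZr /jump dotBr !(@dot_ztr _ c) ?subrr ?mulr0//.
    - by move=> z; exact: a_zvar.
    - by move=> z; exact: a_zvar.
  rewrite /LFflux dotDr dotZr /jump dotBr !a_sol// subrr mulr0 addr0.
  rewrite dot_mulmx; apply: eq_bigr => l _; congr (_ * _).
  have -> : row l (2^-1 *: (flux G (y e x) + flux G (y e' x))) =
      2^-1 *: (row l (flux G (y e x)) + row l (flux G (y e' x))).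
    by apply/rowP => i; rewrite !mxE.
  by rewrite dotZr dotDr !ab//; lra.
by rewrite mulr_sumr; apply: eq_bigr => l _; ring.
Qed.

(** All coefficients of a z are equal, so they coincide with their mean. *)
Lemma dot_correction0 k : dot a (correction G K lam Y e k) = 0.
Proof.
rewrite /correction; case: asboolP => _; first by rewrite dot0r.
have zc j : dot a (row j (zhat G K Y e)) = c.
  by apply: row_proj_const => x; exact: a_zvar.
rewrite dotZr dotBr zc /mean_coeff dotZr dot_sumr.
under eq_bigr do rewrite zc.
rewrite sumr_const card_ord -[c *+ nb]mulr_natl mulrA mulVf ?mul1r ?subrr ?mulr0//.
by rewrite pnatr_eq0; case: (nb) k => // -[].
Qed.

Lemma dot_ddt0 (dY : coeffs) : scheme_at G K lam Y e dY ->
  forall j, dot a (row j dY) = 0.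
Proof.
move=> sch j.
suff : mass (K e) *m (\col_j dot a (row j dY)) = 0.
  move=> /(congr1 (mulmx (invmx (mass (K e))))).
  rewrite mulmxA mulVmx ?mass_unit// mul1mx mulmx0 => /colP/(_ j).
  by rewrite !mxE.
apply/colP => k; rewrite mxE [RHS]mxE.
have := congr1 (dot a) (sch k).
rewrite !dotDr dot_residual0 dot_correction0 !addr0 dot0r dot_sumr; apply: etrans.
by apply: eq_bigr => i _; rewrite dotZr [X in _ * X]mxE.
Qed.

End balanced_mode.

Lemma slip_ddt0 (dY : coeffs) k : scheme_at G K lam Y e dY ->
  forall j, dot (slip_mode G v0 k) (row j dY) = 0.
Proof.
apply: (@dot_ddt0 _ 0 0) => e' x clx.
  exact/dot_slip_equilibrium/Yeq.
by apply: dot_slip_zvar; exact: Yeq.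
Qed.

Lemma pres_ddt0 (dY : coeffs) : scheme_at G K lam Y e dY ->
  forall j, pres (row j dY) = 0.
Proof.
move=> sch j; rewrite -(@dot_pres R d ns).
apply: (@dot_ddt0 _ P0 P0) sch j => e' x clx; rewrite dot_pres.
  by have [] := Yeq clx.
by apply: pres_zvar; exact: Yeq.
Qed.

End scheme_at_equilibrium.

(** * The total energy balance *)

Section energy_balance.
Context {R : realType} {d ns p nb : nat} (G : mixture R ns).
Context {E : finType} (K : E -> element R d p nb).
Local Notation state := 'rV[R]_(d + 1 + ns).
Local Notation coeffs := 'M[R]_(nb, d + 1 + ns).
Variables (lam : E -> E -> 'rV[R]_d -> R) (Y : E -> coeffs).

Local Notation y := (sol K Y).

(** The numerator of beta is the amount that makes the jump of w, paired with the
    corrected flux, equal to the jump of (w F - F_et).n. With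
    {{w}} = w^+ - [[w]]/2 the terms of the neighbor then cancel. *)
Lemma Fdag_et_corrected e e' x :
  e' != e -> face K e e' x -> corrected_face K Y e e' -> beta_den_nonzero G K Y e ->
  Fdag_et G K lam Y e e' x =
  dot (wtr G K Y e x) (Fdag G K lam Y e e' x) +
  dot (flux_et G (y e x) - wflux G (wtr G K Y e x) (y e x)) (normal (K e) x).
Proof.
move=> e'e xf cf bden.
set w := wtr G K Y e x; set w' := wtr G K Y e' x; set n := normal (K e) x.
set F := Fdag G K lam Y e e' x.
have shuffle : dot (jump w w') F =
    - dot (jump (flux_et G (y e x)) (flux_et G (y e' x))) n
    + dot (jump (wflux G w (y e x)) (wflux G w' (y e' x))) n.
  rewrite /F /Fdag asboolT// dotDr dotZr /beta.
  (* Without jumps both sides vanish; otherwise beta times its denominator is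
     its numerator. *)
  have [noj|j] := boolP (no_jump _ _ _ _ _ _).
    move: noj => /andP[/eqP jy /eqP jw]; rewrite mul0r addr0 /w /w' jw dot0l.
    have yy : y e x = y e' x by apply/eqP; rewrite -subr_eq0; exact/eqP.
    have ww : w = w' by apply/eqP; rewrite -subr_eq0; exact/eqP.
    by rewrite -/w -/w' ww yy /jump !subrr !dot0l oppr0 addr0.
  rewrite -[dot (jump w w') (jump _ _)]/(beta_den G K Y e e' x).
  by rewrite divfK; [rewrite -/w -/w' -/n; ring|exact: bden].
rewrite /Fdag_et -/w -/w' -/n -/F dotC dot_avg [dot (avg (wflux _ _ _) _) _]dotC dot_avg.
rewrite [dot (avg w _) _]dotC dot_avg.
move: shuffle; rewrite /jump !dotBl ![dot n _]dotC ![dot F _]dotC; lra.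
Qed.

Lemma sum_sub_mean (A : coeffs) : \sum_k (row k A - mean_coeff A) = 0.
Proof.
rewrite sumrB sumr_const card_ord /mean_coeff.
case: nb A => [|m] A; first by rewrite big_ord0 mulr0n subr0.
by rewrite -scaler_nat scalerA mulfV ?pnatr_eq0// scale1r subrr.
Qed.

(** The differences from the mean add up to zero, so w-hat may be replaced by
    w-hat minus its mean; this is the denominator of alpha. *)
Lemma dot_correction e : ~ is_constant (K e) (Y e) -> alpha_den_nonzero G K Y e ->
  \sum_k dot (row k (what G K Y e)) (correction G K lam Y e k) =
  surf_int K e (Fdag_et G K lam Y e) -
  \sum_k dot (row k (what G K Y e)) (row k (residual G K lam Y e)).
Proof.
move=> nc aden.
transitivity (alpha G K lam Y e * alpha_den G K Y e); last first.
  by rewrite /alpha divfK//; exact: aden.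
transitivity (alpha G K lam Y e * \sum_k dot (row k (what G K Y e))
    (row k (zhat G K Y e) - mean_coeff (zhat G K Y e))).
  by rewrite mulr_sumr; apply: eq_bigr => k _; rewrite /correction asboolF// dotZr.
congr (_ * _); rewrite /alpha_den; under [RHS]eq_bigr do rewrite dotBl.
by rewrite sumrB -[X in _ = _ - X]dot_sumr sum_sub_mean dot0r subr0.
Qed.

Variables (P0 : R) (v0 : 'rV[R]_d) (e : E).
Hypothesis Kproj : forall e', proj_reproduces_constants (K e').
Hypothesis e_interior : all_faces_interior K e.
Hypothesis Yeq : forall e' x, closure (dom (K e')) x -> equilibrium G P0 v0 (y e' x).
Hypothesis Fint : surface_integrable G K lam Y e.
Hypothesis beta_neq0 : beta_den_nonzero G K Y e.
Hypothesis alpha_neq0 : alpha_den_nonzero G K Y e.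

Local Notation F := (Fdag G K lam Y e).
Local Notation n := (normal (K e)).

Lemma normal_integrable l :
  (sigma (K e)).-integrable (frontier (dom (K e))) (EFin \o (fun x => n x ord0 l)).
Proof.
have := @peval_normal_integrable _ _ _ _ (K e) 1 l.
by under [X in EFin \o X]eq_fun do rewrite peval1 mul1r.
Qed.

(** Gauss-Green for a constant field. *)
Lemma surf_int_normal0 (b : 'I_d -> R) :
  surf_int K e (fun _ x => \sum_l b l * n x ord0 l) = 0.
Proof.
rewrite (@surf_intZ_sum _ _ _ _ _ K e _ _ b (fun l _ x => n x ord0 l)); last first.
  by move=> l e' _; apply: face_integrable; exact: normal_integrable.
rewrite big1// => l _.
have := @green _ _ _ _ _ K e 1 l e_interior.
under eq_surf_int do rewrite peval1 mul1r.
move=> ->; rewrite (_ : mpoly.mderiv l 1 = 0); last exact: mpoly.mderivC.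
under eq_Rintegral do rewrite /peval mpoly.meval0.
by rewrite /Rintegral integral0 mulr0.
Qed.

Lemma surf_int_sum_phi (g : E -> 'rV[R]_d -> R) :
  (forall k e', e' != e -> (sigma (K e)).-integrable (face K e e')
     (EFin \o (fun x => peval (phi (K e) k) x * g e' x))) ->
  \sum_k surf_int K e (fun e' x => peval (phi (K e) k) x * g e' x) = surf_int K e g.
Proof.
move=> gint; under eq_bigr do rewrite -[surf_int _ _ _]mul1r.
rewrite -surf_intZ_sum//; apply: eq_surf_int => e' x _ _.
by under eq_bigr do rewrite mul1r; rewrite -mulr_suml sum_phi mul1r.
Qed.

(** Every face of a constant element carries the corrected flux, and w-hat is the
    same vector w at all nodes. As the phi_k add up to 1, pairing w with
    the sum of the residuals gives the surface integral of w F^dag, up to that of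
    a constant field, which is zero; F^dag_et differs from w F^dag by another
    constant field. *)
Lemma constant_element_balance : is_constant (K e) (Y e) ->
  \sum_k dot (row k (what G K Y e)) (row k (residual G K lam Y e)) =
  surf_int K e (Fdag_et G K lam Y e).
Proof.
move=> cst_e; have [c cE] := cst_e.
have ycl x : closure (dom (K e)) x -> y e x = c by exact: interp_closure.
pose w := wvar G c.
have what_w k : row k (what G K Y e) = w.
  apply/rowP => i; rewrite -!dot_delta; apply: row_proj_const => // x clx.
  by rewrite ycl.
have wtr_w x : wtr G K Y e x = w.
  rewrite /wtr interp_row; under eq_bigr do rewrite what_w.
  by rewrite -scaler_suml sum_phi scale1r.
pose b l := wflux G w c ord0 l.
have dotFint k e' : e' != e -> (sigma (K e)).-integrable (face K e e')
    (EFin \o (fun x => peval (phi (K e) k) x * dot w (F e' x))).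
  move=> e'e; apply: (eq_integrable (face_measurable K e e')
    (fun x => (\sum_i w ord0 i * (peval (phi (K e) k) x * F e' x ord0 i))%:E)).
    move=> x _; congr EFin; rewrite /dot mulr_sumr; apply: eq_bigr => i _.
    by rewrite mulrCA.
  by apply: integrableZ_sum => [|i]; [exact: face_measurable|exact: Fint].
have -> : \sum_k dot (row k (what G K Y e)) (row k (residual G K lam Y e)) =
    surf_int K e (fun e' x => dot w (F e' x)).
  transitivity (\sum_k (surf_int K e (fun e' x => peval (phi (K e) k) x * dot w (F e' x))
      - surf_int K e (fun _ x => peval (phi (K e) k) x * \sum_l b l * n x ord0 l))).
    apply: eq_bigr => k _.
    rewrite what_w (dot_residual_const e_interior Yeq Fint (b := b)).
      congr (_ - _); apply: eq_surf_int => e' x _ _; rewrite mulr_sumr.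
      by apply: eq_bigr => l _; rewrite mulrCA.
    by move=> l x Kx; rewrite ycl /b ?mxE//; exact: subset_closure.
  rewrite sumrB !surf_int_sum_phi ?surf_int_normal0 ?subr0// => k e' _.
  apply: face_integrable.
  apply: (eq_integrable (frontier_measurable (dom (K e))) (fun x =>
    (\sum_l b l * (peval (phi (K e) k) x * n x ord0 l))%:E)).
    by move=> x _; rewrite /= mulr_sumr; congr EFin; apply: eq_bigr => l _; rewrite mulrCA.
  apply: integrableZ_sum => [|l]; first exact: frontier_measurable.
  exact: peval_normal_integrable.
(* The constant field by which w F^dag and F^dag_et differ. *)
pose r l := b l - flux_et G c ord0 l.
transitivity (surf_int K e (fun e' x => dot w (F e' x) - \sum_l r l * n x ord0 l)).
  rewrite surf_intB ?surf_int_normal0 ?subr0// => e' e'e.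
    apply: (eq_integrable (face_measurable K e e')
      (fun x => (\sum_k 1 * (peval (phi (K e) k) x * dot w (F e' x)))%:E)).
      move=> x _; congr EFin; under eq_bigr do rewrite mul1r.
      by rewrite -mulr_suml sum_phi mul1r.
    apply: integrableZ_sum => [|k]; [exact: face_measurable|exact: dotFint].
  apply: face_integrable; apply: integrableZ_sum; first exact: frontier_measurable.
  by move=> l; exact: normal_integrable.
apply: eq_surf_int => e' x e'e xf; rewrite Fdag_et_corrected//; last by left.
have [/frontier_closure clx _] := xf.
rewrite wtr_w ycl// -/w; congr (_ + _); rewrite -sumrN /dot.
by apply: eq_bigr => l _; rewrite /r /b !mxE; ring.
Qed.

Lemma energy_balance (dY : coeffs) : scheme_at G K lam Y e dY ->
  \sum_k \sum_j dot (row k (what G K Y e)) (mass (K e) k j *: row j dY) =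
  - surf_int K e (Fdag_et G K lam Y e).
Proof.
move=> sch.
transitivity (- (\sum_k dot (row k (what G K Y e)) (row k (residual G K lam Y e)) +
   \sum_k dot (row k (what G K Y e)) (correction G K lam Y e k))).
  rewrite -big_split -sumrN; apply: eq_bigr => k _ /=.
  rewrite -dot_sumr; apply/eqP; rewrite -addr_eq0 -!dotDr addrA.
  by rewrite sch dot0r.
have [ce|nce] := pselect (is_constant (K e) (Y e)); last first.
  by rewrite dot_correction// addrC subrK.
rewrite constant_element_balance// [X in _ + X]big1 ?addr0// => k _.
by rewrite /correction asboolT// dot0r.
Qed.

End energy_balance.

(** * Time derivatives *)

Section time_derivatives.
Context {R : realType} {d ns p nb : nat} (G : mixture R ns).
Local Notation state := 'rV[R]_(d + 1 + ns).
Local Notation coeffs := 'M[R]_(nb, d + 1 + ns).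

Lemma is_derive_dot n (a : 'rV[R]_n) (Z : R -> 'rV[R]_n) (dZ : 'rV[R]_n) (t : R) :
  (forall i, is_derive t 1 (fun s => Z s ord0 i) (dZ ord0 i)) ->
  is_derive t 1 (fun s => dot a (Z s)) (dot a dZ).
Proof.
move=> dZi.
have := @is_derive_sum _ _ _ n (fun i s => a ord0 i * Z s ord0 i) t 1
  (fun i => a ord0 i * dZ ord0 i).
by rewrite fct_sumE; apply => i.
Qed.

Lemma is_derive_interp (K : element R d p nb) (Y : R -> coeffs) (t : R) x :
  (forall j i, derivable (fun s => Y s j i) t 1) ->
  forall i, is_derive t 1 (fun s => interp K (Y s) x ord0 i)
    (interp K (ddt_coeffs Y t) x ord0 i).
Proof.
move=> Yder i.
have iE A : interp K A x ord0 i = dot (\row_j peval (phi K j) x) (\row_j A j i).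
  by rewrite interpE /dot; apply: eq_bigr => j _; rewrite !mxE mulrC.
rewrite iE; under eq_fun do rewrite iE.
apply: is_derive_dot => j; rewrite !mxE derive1E; under eq_fun do rewrite mxE.
exact/derivableP.
Qed.

Lemma dot_density (z : state) :
  dot (mk_state (fun=> 0) 0 (molar G) : state) z = density G z.
Proof.
rewrite dot_state !mk_stateE mul0r addr0 big1 ?add0r => [|k _]; last first.
  by rewrite mk_stateE mul0r.
by apply: eq_bigr => i _; rewrite mk_stateE.
Qed.

(** The quotient rule gives rho dv_k/dt = d(rho v_k)/dt - v_k drho/dt, which is
    the slip mode of dZ. *)
Lemma is_derive_vel0 (Z : R -> state) (dZ : state) (v : 'rV[R]_d) (t : R) k :
  (forall i, is_derive t 1 (fun s => Z s ord0 i) (dZ ord0 i)) ->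
  density G (Z t) != 0 -> vel G (Z t) ord0 k = v ord0 k ->
  dot (slip_mode G v k) dZ = 0 ->
  is_derive t 1 (fun s => vel G (Z s) ord0 k) 0.
Proof.
move=> dZi r0 vk; rewrite dot_slip => /eqP; rewrite subr_eq0 => /eqP momd.
have dr : is_derive t 1 (fun s => density G (Z s)) (density G dZ).
  by rewrite -dot_density; under eq_fun do rewrite -dot_density; exact: is_derive_dot.
have dm : is_derive t 1 (fun s => mom (Z s) k) (mom dZ k) by exact: dZi.
have := is_deriveM dm (is_deriveV r0 dr).
rewrite (_ : _ * _ = fun s => vel G (Z s) ord0 k); last first.
  by apply/funext => s; rewrite /= mxE.
rewrite (_ : _ + _ = 0)// momd -vk mxE /GRing.scale /=.
by field.
Qed.

(** The projection is M^-1 Vq^T W, so M applied to the coefficients of the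
    projection of w is the quadrature of w against the basis; both sides are the
    trace of the same product of matrices. *)
Lemma quadrature_projection (K : element R d p nb) (w : state -> state) (A B : coeffs) :
  \sum_i qwt K ord0 i * dot (w (interp K A (qpt K i))) (interp K B (qpt K i)) =
  \sum_k \sum_j dot (row k (Defs.proj K w A)) (mass K k j *: row j B).
Proof.
have trE m (M N : 'M[R]_(m, d + 1 + ns)) : \sum_k dot (row k M) (row k N) = \tr (M *m N^T).
  by apply: eq_bigr => k _; rewrite mxE; apply: eq_bigr => i _; rewrite !mxE.
pose W := \matrix_i w (row i (Vq K *m A)).
transitivity (\tr (diag_mx (qwt K) *m W *m (Vq K *m B)^T)).
  rewrite -trE; apply: eq_bigr => i _.
  by rewrite -dotZl !row_Vq row_mul row_diag_mx -scalemxAl -rowE rowK row_Vq.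
transitivity (\tr (Defs.proj K w A *m (mass K *m B)^T)); last first.
  rewrite -trE; apply: eq_bigr => k _.
  rewrite -dot_sumr; congr (dot _ _); rewrite row_mul mulmx_sum_row.
  by apply: eq_bigr => j _; rewrite [row k _ _ _]mxE.
rewrite !trmx_mul mass_sym [X in _ = \tr X]mulmxA [RHS]mxtrace_mulC.
rewrite /Defs.proj /Defs.proj_mx -!mulmxA mulKVmx ?mass_unit//.
by rewrite [RHS]mxtrace_mulC !mulmxA.
Qed.

End time_derivatives.

Theorem theorem17 (R : realType) (d ns p nb : nat) (G : mixture R ns)
    (E : finType) (K : E -> element R d p nb)
    (lam : E -> E -> 'rV[R]_d -> R)
    (Y : R -> E -> 'M[R]_(nb, d + 1 + ns)) (t : R) (e : E)
    (P0 : R) (v0 : 'rV[R]_d)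
    (Kdisj : disjoint_elements K)
    (Kproj : forall e', proj_reproduces_constants (K e'))
    (e_interior : all_faces_interior K e)
    (lam_sym : forall e1 e2 x, face K e1 e2 x -> lam e1 e2 x = lam e2 e1 x)
    (Yadm : admissible G K (Y t))
    (YPV : uniform_PV G K (Y t) P0 v0)
    (Yder : forall j i, derivable (fun s => Y s e j i) t 1)
    (Fint : surface_integrable G K lam (Y t) e)
    (beta_neq0 : beta_den_nonzero G K (Y t) e)
    (alpha_neq0 : alpha_den_nonzero G K (Y t) e)
    (Yscheme : scheme_at G K lam (Y t) e (ddt_coeffs (fun s => Y s e) t)) :
  [/\ forall x, closure (dom (K e)) x -> forall k : 'I_d,
        is_derive t 1 (fun s => vel G (sol K (Y s) e x) ord0 k) 0,
      forall x, closure (dom (K e)) x ->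
        is_derive t 1 (fun s => pres (sol K (Y s) e x)) 0,
      forall i, derivable (fun s => rhoet G (sol K (Y s) e (qpt (K e) i))) t 1,
      \sum_i qwt (K e) ord0 i *
          derive1 (fun s => rhoet G (sol K (Y s) e (qpt (K e) i))) t
        = \sum_k \sum_j dot (row k (what G K (Y t) e))
            (mass (K e) k j *: row j (ddt_coeffs (fun s => Y s e) t))
    & \sum_k \sum_j dot (row k (what G K (Y t) e))
          (mass (K e) k j *: row j (ddt_coeffs (fun s => Y s e) t))
        = - surf_int K e (Fdag_et G K lam (Y t) e)].
Proof.
have Yeq e' x : closure (dom (K e')) x -> equilibrium G P0 v0 (sol K (Y t) e' x).
  by move=> clx; have [] := YPV _ _ clx; have [] := Yadm _ _ clx.
set dY := ddt_coeffs _ _ in Yscheme *.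
have dsol x i : is_derive t 1 (fun s => sol K (Y s) e x ord0 i) (interp (K e) dY x ord0 i).
  exact: is_derive_interp.
have dot_dY0 a x : (forall j, dot a (row j dY) = 0) -> dot a (interp (K e) dY x) = 0.
  by move=> a0; rewrite interp_row dot_sumr big1// => j _; rewrite dotZr a0 mulr0.
have rhoet_chain i :
    let Z s := sol K (Y s) e (qpt (K e) i) in
    derivable (rhoet G \o Z) t 1 /\
    derive1 (rhoet G \o Z) t = dot (wvar G (Z t)) (interp (K e) dY (qpt (K e) i)).
  move=> Z; have [r0 C0] := Yadm _ _ (@qpt_in _ _ _ _ (K e) i).
  have [||Zder ->] := @chain_rule_rV _ _ (@rhoet R d ns G) Z t.
  - by apply: differentiable_rhoet => //; rewrite gt_eqF.
  - by move=> j; exact: ex_derive.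
  split => //; apply: eq_bigr => j _; rewrite mxE derive1E.
  by congr (_ * _); have [_ ->] := dsol (qpt (K e) i) j.
split.
- move=> x clx k; have [r0 _ vx] := Yeq _ _ clx.
  apply: (is_derive_vel0 (v := v0) (dsol x)); rewrite ?vx ?gt_eqF//.
  by apply: dot_dY0; exact: (slip_ddt0 Kproj e_interior Yeq Fint k Yscheme).
- move=> x clx; have dP := is_derive_dot (@pres_mode R d ns) (dsol x).
  rewrite dot_dY0 in dP; last first.
    by move=> j; rewrite dot_pres; exact: (pres_ddt0 Kproj e_interior Yeq Fint Yscheme).
  by rewrite (_ : (fun s => pres _) = fun s => dot (pres_mode) (sol K (Y s) e x))//;
    apply/funext => s; rewrite dot_pres.
- by move=> i; exact: (rhoet_chain i).1.
- rewrite -quadrature_projection; apply: eq_bigr => i _; congr (_ * _).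
  exact: (rhoet_chain i).2.
- exact: (energy_balance Kproj e_interior Yeq Fint beta_neq0 alpha_neq0 Yscheme).
Qed.
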